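(* $\mathfrak{X}^\infty_m(M)$ is $C^1$-dense in $\mathfrak{X}^1_m(M)$; that is, for every $X\in\mathfrak{X}^1_m(M)$ and every $\varepsilon>0$ there exists $Z\in\mathfrak{X}^\infty_m(M)$ which is $\varepsilon$-$C^1$-close to $X$.
   Context: $M$ is a compact smooth manifold (without boundary) with a smooth volume $m$. For $r=1$ or $r=\infty$, $\mathfrak{X}^r_m(M)$ is the set of $C^r$ vector fields on $M$ that are conservative, i.e. divergence free with respect to $m$. *)

(* Defs.v *)
From HB Require Import structures.
From mathcomp Require Import all_boot all_order all_algebra.
From mathcomp Require Import all_classical all_reals all_analysis.

Set Implicit Arguments.
Unset Strict Implicit.
Unset Printing Implicit Defensive.

Import Order.TTheory GRing.Theory Num.Theory.
Import numFieldNormedType.Exports.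

Local Open Scope classical_set_scope.
Local Open Scope ring_scope.

(* Points and tangent vectors of R^n are row vectors, so that the differential
   of f at x acts by v |-> v *m 'J f x. *)

Definition basis_vec (R : realType) (n : nat) (a : 'I_n) : 'rV[R]_n :=
  delta_mx 0 a.

(* f is of class C^k on U; only used for open U. *)
Fixpoint Ck (R : realType) (n : nat) (V : normedModType R) (k : nat)
    (U : set 'rV[R]_n) (f : 'rV[R]_n -> V) : Prop :=
  match k with
  | 0 => forall x, U x -> {for x, continuous f}
  | k'.+1 => (forall x, U x -> differentiable f x) /\
             (forall a : 'I_n, Ck k' U (fun x => 'D_(basis_vec R a) f x))
  end.

Definition Coo (R : realType) (n : nat) (V : normedModType R)
    (U : set 'rV[R]_n) (f : 'rV[R]_n -> V) : Prop :=
  forall k, Ck k U f.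

(* A homeomorphism from the open set dom of M onto the open set cod of R^n.
   The values of to outside dom and of from outside cod are irrelevant. *)
Record chart (R : realType) (n : nat) (M : topologicalType) := Chart {
  dom : set M ;
  cod : set 'rV[R]_n ;
  to : M -> 'rV[R]_n ;
  from : 'rV[R]_n -> M ;
  dom_open : open dom ;
  cod_open : open cod ;
  to_cod : forall p, dom p -> cod (to p) ;
  from_dom : forall x, cod x -> dom (from x) ;
  toK : forall p, dom p -> from (to p) = p ;
  fromK : forall x, cod x -> to (from x) = x ;
  to_continuous : forall p, dom p -> {for p, continuous to} ;
  from_continuous : forall x, cod x -> {for x, continuous from}
}.

(* The change of coordinates from c to d, and the open set it is defined on. *)
Definition transition (R : realType) (n : nat) (M : topologicalType)
  (c d : chart R n M) : 'rV[R]_n -> 'rV[R]_n := fun x => to d (from c x).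

Definition overlap (R : realType) (n : nat) (M : topologicalType)
  (c d : chart R n M) : set 'rV[R]_n := [set x | cod c x /\ dom d (from c x)].

(* An n-dimensional smooth manifold without boundary. The atlas need not be
   maximal: regularity, divergence and the C^1 topology below are the same for
   all compatible atlases. *)
Record smooth_manifold (R : realType) (n : nat) := SmoothManifold {
  carrier :> topologicalType ;
  carrier_hausdorff : hausdorff_space carrier ;
  carrier_second_countable : @second_countable carrier ;
  atlas_index : Type ;
  ch : atlas_index -> chart R n carrier ;
  ch_cover : forall p : carrier, exists i, dom (ch i) p ;
  ch_compatible : forall i j,
    Coo (overlap (ch i) (ch j)) (transition (ch i) (ch j))
}.

(* A smooth positive density: in the chart i, the volume is
   (density p i) dx_1 ... dx_n. The absolute value makes sense of it on
   non-orientable manifolds too; on an oriented manifold it is the same datum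
   as a positive volume form. *)
Record smooth_volume (R : realType) (n : nat) (M : smooth_manifold R n) :=
  SmoothVolume {
  density :> M -> atlas_index M -> R ;
  density_gt0 : forall p i, dom (ch i) p -> 0 < density p i ;
  density_change : forall p i j, dom (ch i) p -> dom (ch j) p ->
    density p i =
    density p j * `|\det ('J (transition (ch i) (ch j)) (to (ch i) p))| ;
  density_smooth : forall i,
    Coo (cod (ch i)) (fun x => density (from (ch i) x) i : R^o)
}.

(* A tangent vector at p is given by its components in all the charts around p,
   related by the differentials of the changes of coordinates. *)
Definition tangent_vector (R : realType) (n : nat) (M : smooth_manifold R n)
    (p : M) (v : atlas_index M -> 'rV[R]_n) : Prop :=
  forall i j, dom (ch i) p -> dom (ch j) p ->
    v j = v i *m 'J (transition (ch i) (ch j)) (to (ch i) p).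

(* A section of the tangent bundle, without any regularity. *)
Record vector_field (R : realType) (n : nat) (M : smooth_manifold R n) :=
  VectorField {
  component :> M -> atlas_index M -> 'rV[R]_n ;
  component_tangent : forall p, tangent_vector p (component p)
}.

Definition local_field (R : realType) (n : nat) (M : smooth_manifold R n)
    (X : vector_field M) (i : atlas_index M) : 'rV[R]_n -> 'rV[R]_n :=
  fun x => X (from (ch i) x) i.

Definition local_density (R : realType) (n : nat) (M : smooth_manifold R n)
    (m : smooth_volume M) (i : atlas_index M) : 'rV[R]_n -> R :=
  fun x => m (from (ch i) x) i.

(* The divergence with respect to m = rho dx_1 ... dx_n, in coordinates:
   div_m X = rho^-1 \sum_a d(rho X_a)/dx_a, where L_X m = (div_m X) m. *)
Definition divergence (R : realType) (n : nat) (M : smooth_manifold R n)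
    (m : smooth_volume M) (X : vector_field M) (i : atlas_index M)
    (x : 'rV[R]_n) : R :=
  (local_density m i x)^-1 *
  \sum_(a < n) 'D_(basis_vec R a)
    (fun y => local_density m i y * local_field X i y 0 a : R^o) x.

Definition divergence_free (R : realType) (n : nat) (M : smooth_manifold R n)
    (m : smooth_volume M) (X : vector_field M) : Prop :=
  forall i x, cod (ch i) x -> divergence m X i x = 0.

Definition conservative_C1 (R : realType) (n : nat) (M : smooth_manifold R n)
    (m : smooth_volume M) : set (vector_field M) :=
  [set X | (forall i, Ck 1 (cod (ch i)) (local_field X i)) /\
           divergence_free m X].

Definition conservative_Coo (R : realType) (n : nat) (M : smooth_manifold R n)
    (m : smooth_volume M) : set (vector_field M) :=
  [set X | (forall i, Coo (cod (ch i)) (local_field X i)) /\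
           divergence_free m X].

(* The data defining a C^1 norm on the C^1 vector fields of a compact manifold:
   finitely many compact sets, each inside a chart, that cover M. Any two
   choices give equivalent norms. *)
Record C1_gauge (R : realType) (n : nat) (M : smooth_manifold R n) := C1Gauge {
  gauge_size : nat ;
  gauge_chart : 'I_gauge_size -> atlas_index M ;
  gauge_set : 'I_gauge_size -> set 'rV[R]_n ;
  gauge_compact : forall l, compact (gauge_set l) ;
  gauge_sub : forall l, gauge_set l `<=` cod (ch (gauge_chart l)) ;
  gauge_cover : forall p : M, exists l,
    dom (ch (gauge_chart l)) p /\ gauge_set l (to (ch (gauge_chart l)) p)
}.

Arguments gauge_chart [R n M] c _.
Arguments gauge_set [R n M] c _ _.

Lemma C1_gauge_exists (R : realType) (n : nat) (M : smooth_manifold R n) :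
  compact [set: M] -> inhabited (C1_gauge M).
Proof.
move=> /compact_near_coveringP cM.
pose cell := {c : atlas_index M * set 'rV[R]_n |
  compact c.2 /\ c.2 `<=` cod (ch c.1)}.
pose cellT : choiceType := {classic cell}.
pose cov (c : cellT) (p : M) := let c' := sval (c : cell) in
  dom (ch c'.1) p /\ c'.2 (to (ch c'.1) p).
pose F : set_system (seq cellT) :=
  [set S | exists s0 : seq cellT, forall s : seq cellT, {subset s0 <= s} -> S s].
have FF : Filter F.
  split=> [|S T [s sS] [t tT]|S T ST [s sS]]; first by exists (@nil cellT).
  - exists (s ++ t) => u stu; split; [apply: sS|apply: tT] => c cs; apply: stu.
      by rewrite mem_cat cs.
    by rewrite mem_cat cs orbT.
  - by exists s => u su; exact/ST/sS.
have [p _|s0 /(_ s0)] :=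
    cM _ F (fun s p => exists2 c, c \in s & cov c p) FF.
- have [i ip] := ch_cover p.
  have : nbhs (to (ch i) p) (cod (ch i)).
    by apply: open_nbhs_nbhs; split; [exact: cod_open|exact: to_cod].
  move=> /nbhs_closedballP[r rcod].
  have cK : compact (closed_ball (to (ch i) p) r%:num).
    apply: bounded_closed_compact; last exact: closed_ball_closed.
    rewrite closed_ballE//; exists (r%:num + `|to (ch i) p|).
    split=> [|b rb y /= yr]; first exact: num_real.
    apply: le_trans (ltW rb).
    rewrite -[y](subrK (to (ch i) p)) (le_trans (ler_normD _ _))// lerD2r.
    by rewrite distrC.
  pose c : cell := exist _ (i, closed_ball (to (ch i) p) r%:num) (conj cK rcod).
  near=> q s => /=.
  have cs : (c : cellT) \in s.
    by near: s; exists [:: c : cellT] => s; apply; rewrite mem_head.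
  exists (c : cellT) => //; split=> /=; near: q.
    by apply: open_nbhs_nbhs; split=> //; exact: dom_open.
  apply: (to_continuous ip).
  apply: filterS (nbhsx_ballx _ _ _); first exact: subset_closed_ball.
  by [].
- move=> /(_ (fun _ => id)) s0cov; split.
  pose g l := sval (tnth (in_tuple s0) l : cell).
  apply: (@C1Gauge _ _ _ (size s0) (fun l => (g l).1) (fun l => (g l).2)).
  + by move=> l; have [] := svalP (tnth (in_tuple s0) l : cell).
  + by move=> l; have [] := svalP (tnth (in_tuple s0) l : cell).
  + move=> p; have [c /(tnthP (in_tuple s0))[l ->] cp] := s0cov p I.
    by exists l.
Unshelve. all: by end_near. Qed.

Definition C1_close (R : realType) (n : nat) (M : smooth_manifold R n)
    (G : C1_gauge M) (e : R) (X Z : vector_field M) : Prop :=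
  forall l x, gauge_set G l x ->
    let i := gauge_chart G l in
    `|local_field X i x - local_field Z i x| < e /\
    `|'J (local_field X i) x - 'J (local_field Z i) x| < e.

(* Main.v *)
From HB Require Import structures.
From mathcomp Require Import all_boot all_order all_algebra.
From mathcomp Require Import all_classical all_reals all_analysis.
From mathcomp Require Import perm ring lra.
Require Import Defs.
Import Order.TTheory GRing.Theory Num.Theory.
Import numFieldNormedType.Exports.
Local Open Scope classical_set_scope.
Local Open Scope ring_scope.
Set Implicit Arguments.
Unset Strict Implicit.
Unset Printing Implicit Defensive.

(** The theorem is proved by smoothing [X] little by little: within one chart at a
    time, and in one coordinate direction at a time.

    Mollifying the components of [X] in a chart preserves the divergence only if
    it is done everywhere, and cutting the result off destroys it. The way out is
    to see mollification as the addition of a field with a potential, and to cut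
    off the potential. In a chart where the volume is rho dx_1 ... dx_n, let
    Y = rho X, which has zero Euclidean divergence. Let kappa be a smooth function
    on [0, 1] equal to 1 near 0 and to 0 near 1, and put, for a direction a,

      A Y (x) = eps int_0^1 kappa(u) Y(x + eps u e_a) du,
      T Y (x) = int_0^1 (- kappa')(u) Y(x + eps u e_a) du.

    An integration by parts gives d_a (A Y) = T Y - Y ([mollified_sub]). For a
    cutoff chi the field

      W = d_a (chi A Y) - div (chi A Y) e_a

    is supported in the support of chi and has zero divergence
    ([correction_divergence]). As div (A Y) = A (div Y) = 0, no derivative of Y
    remains when W is expanded, so that W has the regularity of Y
    ([correction_Cp]). Where chi = 1 one has Y + W = T Y, and T Y has derivatives
    of all orders in the direction a, even for a continuous Y, because they can
    be put on the kernel kappa' ([Cp_lineavg_gain], [corrected_gain]). Finally W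
    and its first derivatives tend to 0 with eps ([correction_limit],
    [dcorrection_limit]), since T tends to the identity and A to 0.

    Thus X + W / rho is a conservative field, C^1-close to X, which has gained the
    direction a near a given point and lost nothing elsewhere. To see this in all
    charts, one needs the chain rule for the components of a field
    ([push_limit]) and the invariance of the divergence ([divergence_push]), which
    rests on Jacobi's formula for the derivative of a determinant and on the
    symmetry of second derivatives. The estimates hold near every point for small
    eps; the compactness of [M] provides one eps for all points
    ([smooth_one_direction]).

    Going through the n directions makes the field smooth on a ball of the chart
    ([smooth_directions]), and the points where it was already smooth remain so.
    Hence finitely many balls covering [M] can be treated one after the other
    ([smoothableU], [smoothableT]), with a total displacement as small as
    desired. *)

(** * Iterated partial derivatives in chosen directions *)

Notation pd a f := ('D_(basis_vec _ a) f).

Section partials.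
Context {R : realType} {n : nat}.
Implicit Types (f g : 'rV[R]_n -> R) (U V : set 'rV[R]_n) (S : {pred 'I_n}).

(** Partial derivatives of order at most [k] in the directions of [S] exist and
    are continuous; nothing is asked of the other directions. With [S] empty
    this is continuity, with [S] full it is the class C^k. The smoothing below
    enlarges [S] by one direction at a time, and this is why the notion is
    stated with partials instead of differentials. *)
Fixpoint Cp S (k : nat) U f : Prop :=
  (forall x, U x -> {for x, continuous f}) /\
  if k is k'.+1 then forall a, a \in S ->
    (forall x, U x -> derivable f x (basis_vec R a)) /\ Cp S k' U (pd a f)
  else True.

Lemma Cp_continuous S k U f x : Cp S k U f -> U x -> {for x, continuous f}.
Proof. by case: k => [|k] [cf _] Ux; exact: cf. Qed.

Lemma Cp_derivable S k U f a x :
  Cp S k.+1 U f -> a \in S -> U x -> derivable f x (basis_vec R a).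
Proof. by move=> [_ /[apply]-[+ _]]; exact. Qed.

Lemma Cp_pd S k U f a : Cp S k.+1 U f -> a \in S -> Cp S k U (pd a f).
Proof. by move=> [_ /[apply]-[]]. Qed.

Lemma CpS S k U f : Cp S k.+1 U f -> Cp S k U f.
Proof.
elim: k f => [|k IH] f /= [cf df]; split => // a aS.
by have [ddf Cdf] := df a aS; split => //; exact: IH.
Qed.

Lemma Cp_le S k l U f : (k <= l)%N -> Cp S l U f -> Cp S k U f.
Proof.
move=> /subnK <-; elim: (l - k)%N => // m IH; rewrite addSn => /CpS.
exact: IH.
Qed.

Lemma Cp_subset S S' k U V f : {subset S' <= S} -> V `<=` U ->
  Cp S k U f -> Cp S' k V f.
Proof.
move=> SS VU; elim: k f => [|k IH] f /= [cf df]; split => //.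
- by move=> x /VU; exact: cf.
- by move=> x /VU; exact: cf.
- move=> a /SS/df[ddf Cdf]; split; last exact: IH.
  by move=> x /VU; exact: ddf.
Qed.

Lemma Cp_subopen S k U V f : V `<=` U -> Cp S k U f -> Cp S k V f.
Proof. exact: Cp_subset. Qed.

Lemma near_of_open U x : open U -> U x -> \near x, U x.
Proof. by move=> oU Ux; exact: open_nbhs_nbhs. Qed.

Lemma near_eq_on U f g x : open U -> {in U, f =1 g} -> U x -> \near x, f x = g x.
Proof.
move=> oU fg Ux; apply: filterS (near_of_open oU Ux) => y Uy.
by apply: fg; rewrite inE.
Qed.

Lemma near_eq_continuous f g (x : 'rV[R]_n) : (\near x, f x = g x) ->
  {for x, continuous f} -> {for x, continuous g}.
Proof.
move=> fg; have fgx : f x = g x := nbhs_singleton fg.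
move=> cf; have : g @ x --> f x; last by rewrite fgx.
apply: cvg_trans cf.
exact: near_eq_cvg fg.
Qed.

Lemma Cp_eq S k U f g : open U -> {in U, f =1 g} -> Cp S k U f -> Cp S k U g.
Proof.
move=> oU; elim: k f g => [|k IH] f g fg /= [cf df].
  by split => // x Ux; exact/(near_eq_continuous (near_eq_on oU fg Ux))/cf.
split => [x Ux|a /df[ddf Cdf]].
  exact/(near_eq_continuous (near_eq_on oU fg Ux))/cf.
split.
  by move=> x Ux; apply: near_eq_derivable (ddf x Ux); exact: near_eq_on oU fg Ux.
apply: IH Cdf => x; rewrite inE => Ux.
by apply: near_eq_derive; exact: near_eq_on oU fg Ux.
Qed.

(** Regularity is a pointwise matter: a derivative at a point can be computed in
    whichever neighbourhood of that point is convenient. *)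
Lemma Cp_local S k U f :
  (forall x, U x -> exists V, V x /\ Cp S k V f) -> Cp S k U f.
Proof.
elim: k f => [|k IH] f H /=.
  by split => // x /H[V [Vx /Cp_continuous]]; exact.
split; first by move=> x /H[V [Vx /Cp_continuous]]; exact.
move=> a aS; split.
  by move=> x /H[V [Vx /Cp_derivable]]; exact.
by apply: IH => x /H[V [Vx /Cp_pd df]]; exists V; split => //; exact: df.
Qed.

Lemma Cp_cst S k U (c : R) : Cp S k U (fun=> c).
Proof.
elim: k c => [|k IH] c /=.
  by split => // x _; exact: cst_continuous.
split => [x _|a aS]; first exact: cst_continuous.
split => [x _|]; first exact: derivable_cst.
rewrite (_ : pd a _ = fun=> 0) //.
by apply/funext => x; rewrite derive_cst.
Qed.

Lemma CpD S k U f g : open U -> Cp S k U f -> Cp S k U g ->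
  Cp S k U (fun x => f x + g x).
Proof.
move=> oU; elim: k f g => [|k IH] f g /= [cf df] [cg dg].
  by split => // x Ux; exact: (cvgD (cf x Ux) (cg x Ux)).
split => [x Ux|a aS]; first by exact: (cvgD (cf x Ux) (cg x Ux)).
have [ddf Cdf] := df a aS; have [ddg Cdg] := dg a aS.
split; first by move=> x Ux; apply: derivableD; [exact: ddf|exact: ddg].
apply: (@Cp_eq _ _ _ (fun x => pd a f x + pd a g x)) => //; last exact: IH.
move=> x; rewrite inE => Ux; rewrite deriveD//; [exact: ddf|exact: ddg].
Qed.

Lemma CpM S k U f g : open U -> Cp S k U f -> Cp S k U g ->
  Cp S k U (fun x => f x * g x).
Proof.
move=> oU; elim: k f g => [|k IH] f g.
  move=> /= [cf df] [cg dg].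
  by split => // x Ux; exact: (cvgM (cf x Ux) (cg x Ux)).
move=> Cf Cg; have := Cf; have := Cg; move=> /= [cg dg] [cf df].
split => [x Ux|a aS]; first by exact: (cvgM (cf x Ux) (cg x Ux)).
have [ddf Cdf] := df a aS; have [ddg Cdg] := dg a aS.
split; first by move=> x Ux; apply: derivableM; [exact: ddf|exact: ddg].
apply: (@Cp_eq _ _ _ (fun x => f x * pd a g x + g x * pd a f x)) => //; last first.
  by apply: CpD => //; apply: IH => //; exact: CpS.
move=> x; rewrite inE => Ux.
by rewrite (@deriveM _ _ f g) ?scalerE//; [exact: ddf|exact: ddg].
Qed.

Lemma CpN S k U f : open U -> Cp S k U f -> Cp S k U (fun x => - f x).
Proof.
move=> oU Cf; have := CpM oU (@Cp_cst S k U (-1)) Cf.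
by under eq_fun do rewrite mulN1r.
Qed.

Lemma CpB S k U f g : open U -> Cp S k U f -> Cp S k U g ->
  Cp S k U (fun x => f x - g x).
Proof. by move=> oU Cf Cg; apply: CpD => //; exact: CpN. Qed.

Lemma CpV S k U f : open U -> (forall x, U x -> f x != 0) -> Cp S k U f ->
  Cp S k U (fun x => (f x)^-1).
Proof.
move=> oU f0; elim: k => [|k IH].
  by move=> [cf _]; split => // x Ux; exact: (cvgV (f0 x Ux) (cf x Ux)).
move=> Cf; have [cf df] := Cf.
split => [x Ux|a aS]; first by exact: (cvgV (f0 x Ux) (cf x Ux)).
have [ddf Cdf] := df a aS.
split; first by move=> x Ux; apply: derivableV; [exact: f0|exact: ddf].
have Cfk := IH (CpS Cf).
apply: (@Cp_eq _ _ _ (fun x => - (((f x)^-1 * (f x)^-1) * pd a f x))) => //; last first.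
  by apply: CpN => //; apply: CpM => //; exact: CpM.
move=> x; rewrite inE => Ux.
rewrite (@deriveV _ _ f x _ (f0 x Ux) (ddf x Ux)).
by rewrite -[RHS]/(- (f x) ^- 2 * pd a f x) expr2 invfM mulNr.
Qed.

Lemma Cp_sum (I : Type) (r : seq I) (P : pred I) S k U (F : I -> 'rV[R]_n -> R) :
  open U -> (forall i, P i -> Cp S k U (F i)) ->
  Cp S k U (fun x => \sum_(i <- r | P i) F i x).
Proof.
move=> oU CF; elim: r => [|i r IH].
  by under eq_fun do rewrite big_nil; exact: Cp_cst.
under eq_fun do rewrite big_cons.
by case: (boolP (P i)) => // /CF CFi; exact: CpD.
Qed.

Lemma Cp_prod (I : Type) (r : seq I) (P : pred I) S k U (F : I -> 'rV[R]_n -> R) :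
  open U -> (forall i, P i -> Cp S k U (F i)) ->
  Cp S k U (fun x => \prod_(i <- r | P i) F i x).
Proof.
move=> oU CF; elim: r => [|i r IH].
  by under eq_fun do rewrite big_nil; exact: Cp_cst.
under eq_fun do rewrite big_cons.
by case: (boolP (P i)) => // /CF CFi; exact: CpM.
Qed.

End partials.

(** * Mean value estimates and differentiability of C^1 functions *)

Section along_a_line.
Context {R : realType} {V : normedModType R}.
Implicit Types (f : V -> R) (x v : V).

Lemma is_derive_line f x v t :
  derivable f (x + t *: v) v ->
  is_derive t 1 (fun s : R => f (x + s *: v)) ('D_v f (x + t *: v)).
Proof.
have E : (fun h : R => h^-1 *: (((fun s : R => f (x + s *: v)) \o shift t) (h *: 1)
      - f (x + t *: v))) =
    (fun h => h^-1 *: ((f \o shift (x + t *: v)) (h *: v) - f (x + t *: v))).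
  apply/funext => h /=; congr (_ *: (f _ - _)).
  by rewrite [h *: 1]mulr1 scalerDl addrCA.
by move=> df; split; rewrite /derivable /derive E.
Qed.

(** A directional derivative involves only the restriction of the function to a
    line, so that the calculus of one variable applies to it. *)
Lemma line_is_derive f x v d :
  is_derive (0 : R) 1 (fun s : R => f (x + s *: v)) d -> is_derive x v f d.
Proof.
have E : (fun h : R => h^-1 *: (((fun s : R => f (x + s *: v)) \o shift 0) (h *: 1)
      - f (x + 0 *: v))) =
    (fun h => h^-1 *: ((f \o shift x) (h *: v) - f x)).
  apply/funext => h /=; rewrite scale0r addr0 [h *: 1]mulr1 addr0.
  by rewrite [x + _]addrC.
by move=> [df vd]; split; move: df vd; rewrite /derivable /derive E.
Qed.

Lemma is_derive_scale f x v (c d : R) :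
  is_derive x v f d -> is_derive x (c *: v) f (c * d).
Proof.
move=> [df <-]; apply: line_is_derive.
have -> : (fun s : R => f (x + s *: (c *: v))) =
    (fun s : R => f (x + s *: v)) \o (fun s => s * c).
  by apply/funext => s /=; rewrite scalerA.
rewrite mulrC; apply: is_derive1_comp.
  by have := @is_derive_line f x v 0; rewrite mul0r scale0r addr0; exact.
have -> : ( *%R^~ c) = c \*: (@id R) by apply/funext => s; rewrite /= mulrC.
by apply: is_derive_eq; rewrite [_ *: _]mulr1.
Qed.

(** The intermediate point is located by its norm only, which lets the increment
    [h] have either sign. *)
Lemma MVT_line f x v (h : R) :
  (forall t : R, `|t| <= `|h| -> derivable f (x + t *: v) v) ->
  exists2 s : R, `|s| <= `|h| &
    f (x + h *: v) - f x = h * 'D_v f (x + s *: v).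
Proof.
move=> df.
have dline (t : R) : `|t| <= `|h| -> is_derive t 1 (fun s : R => f (x + s *: v))
    ('D_v f (x + t *: v)).
  by move=> /df; exact: is_derive_line.
have cline (t : R) : `|t| <= `|h| -> {for t, continuous (fun s : R => f (x + s *: v))}.
  by move=> /dline[/derivable1_diffP/differentiable_continuous].
have [h0|h0] := leP 0 h.
- have [| |s] := @MVT_segment R (fun s => f (x + s *: v))
      (fun s => 'D_v f (x + s *: v)) 0 h h0.
  + move=> t; rewrite in_itv/= => /andP[t0 th]; apply: dline.
    by rewrite !ger0_norm// ltW.
  + apply: continuous_in_subspaceT => t; rewrite inE/= in_itv/= => /andP[t0 th].
    by apply: cline; rewrite !ger0_norm.
  + rewrite in_itv/= => /andP[s0 sh]; rewrite scale0r addr0 subr0 => E.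
    by exists s; [rewrite !ger0_norm|rewrite E mulrC].
- have [| |s] := @MVT_segment R (fun s => f (x + s *: v))
      (fun s => 'D_v f (x + s *: v)) h 0 (ltW h0).
  + move=> t; rewrite in_itv/= => /andP[t0 th]; apply: dline.
    by rewrite !ltr0_norm// lerN2 ltW.
  + apply: continuous_in_subspaceT => t; rewrite inE/= in_itv/= => /andP[t0 th].
    by apply: cline; rewrite (ltr0_norm h0) ler0_norm// lerN2.
  + rewrite in_itv/= => /andP[s0 sh]; rewrite scale0r addr0 sub0r => E.
    exists s; first by rewrite (ltr0_norm h0) ler0_norm// lerN2.
    by apply: oppr_inj; rewrite opprB E mulrN mulrC.
Qed.

End along_a_line.

(** The case of a zero differential; the general case reduces to it by
    subtracting the linear part. *)
Lemma differentiable_flat (R : realType) (V W : normedModType R) (f : V -> W) x :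
  (forall e : R, 0 < e -> \forall h \near 0, `|f (x + h) - f x| <= e * `|h|) ->
  differentiable f x.
Proof.
move=> H.
pose Z : {linear V -> W} := \0.
have cZ : continuous Z by move=> y; exact: cst_continuous.
have E : f \o shift x = cst (f x) + Z +o_ 0 id.
  apply/eqaddoP => e /H; apply: filterS => h.
  rewrite [X in _ -> `|X| <= _](_ : _ = f (x + h) - f x)//.
  rewrite -[LHS]/(f (h + x) - (f x + 0)).
  by rewrite addr0 [h + x]addrC.
by apply/diff_locallyP; rewrite (diff_unique cZ E); split.
Qed.

Section criterion.
Context {R : realType} {n : nat}.
Implicit Types (f g : 'rV[R]_n -> R) (U : set 'rV[R]_n).

Lemma norm_basis_vec (a : 'I_n) : `|basis_vec R a| <= 1.
Proof.
rewrite /Num.norm/= mx_normrE; apply: bigmax_le => // -[i j] _ /=.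
by rewrite mxE; case: (_ && _); rewrite ?normr1 ?normr0.
Qed.

Lemma norm_coord m (x : 'rV[R]_m) (a : 'I_m) : `|x 0 a| <= `|x|.
Proof.
rewrite [leRHS]/Num.norm/= mx_normrE.
exact: (le_bigmax _ (fun ij : 'I_1 * 'I_m => `|x ij.1 ij.2|) (0, a)).
Qed.

Lemma norm_rV_le m (x : 'rV[R]_m) (e : R) : 0 <= e ->
  (forall a, `|x 0 a| <= e) -> `|x| <= e.
Proof.
move=> e0 H; rewrite /Num.norm/= mx_normrE; apply: bigmax_le => // -[i j] _ /=.
by rewrite ord1.
Qed.

Lemma ball_shift (x y : 'rV[R]_n) r : `|y| < r -> ball x r (x + y).
Proof. by move=> yr; rewrite -ball_normE /= opprD addrA subrr sub0r normrN. Qed.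

(** Going from [x] to [x + h] parallel to the axes, one coordinate at a time,
    the mean value theorem bounds each of the [n] increments. *)
Lemma increment_bound f U (x : 'rV[R]_n) (r e : R) :
  ball x r `<=` U -> 0 <= e ->
  (forall a y, U y -> derivable f y (basis_vec R a)) ->
  (forall a y, ball x r y -> `|pd a f y| <= e) ->
  forall h, `|h| < r -> `|f (x + h) - f x| <= n%:R * e * `|h|.
Proof.
move=> xU e0 df fe h hr.
(* [part j] keeps the first [j] coordinates of [h]. *)
pose part (j : nat) : 'rV[R]_n := \row_(c < n) (if (c < j)%N then h 0 c else 0).
have partn : part n = h by apply/rowP => c; rewrite mxE ltn_ord.
have part0 : part 0%N = 0 by apply/rowP => c; rewrite !mxE.
have partS (j : 'I_n) : part j.+1 = part j + h 0 j *: basis_vec R j.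
  apply/rowP => c; rewrite !mxE eqxx/= ltnS leq_eqVlt.
  have [/val_inj ->|cj] := eqVneq (val c) (val j).
    by rewrite eqxx ltnn add0r mulr1.
  have -> : (c == j) = false by apply/negbTE; apply: contraNneq cj => ->.
  by rewrite mulr0 addr0.
have -> : f (x + h) - f x =
    \sum_(j < n) (f (x + part j.+1) - f (x + part j)).
  rewrite -(big_mkord xpredT (fun j => f (x + part j.+1) - f (x + part j))).
  by rewrite telescope_sumr// partn part0 addr0.
apply: le_trans (ler_norm_sum _ _ _) _.
apply: (@le_trans _ _ (\sum_(j < n) e * `|h|)); last first.
  by rewrite sumr_const card_ord -[leLHS]mulr_natl mulrA.
apply: ler_sum => j _; rewrite partS addrA.
have near_part (t : R) : `|t| <= `|h 0 j| ->
    ball x r (x + part j + t *: basis_vec R j).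
  move=> th; rewrite -addrA; apply: ball_shift.
  apply: le_lt_trans hr; apply: norm_rV_le => // c; rewrite !mxE eqxx/=.
  have [->|cj] := eqVneq c j.
    by rewrite ltnn add0r mulr1 (le_trans th)// norm_coord.
  by rewrite mulr0 addr0; case: ifP => _; rewrite ?normr0// norm_coord.
have [t /near_part/xU/df|s sh ->] :=
    @MVT_line _ _ f (x + part j) (basis_vec R j) (h 0 j); first exact.
by rewrite normrM mulrC ler_pM// ?norm_coord// fe//; exact: near_part.
Qed.

(** After subtraction of the candidate differential at [x], all the partial
    derivatives are small near [x], so that [increment_bound] applies. *)
Lemma Cp_differentiable f U x : open U -> U x -> Cp predT 1 U f ->
  differentiable f x.
Proof.
move=> oU Ux Cf.
pose g : 'rV[R]_n -> R := f - (fun y : 'rV[R]_n => \sum_(c < n) pd c f x *: (y 0 c)).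
have dL y : differentiable (fun y : 'rV[R]_n => \sum_(c < n) pd c f x *: (y 0 c)) y.
  rewrite (_ : (fun _ => _) = \sum_(c < n) (fun y : 'rV[R]_n => pd c f x *: (y 0 c))).
    apply: differentiable_sum => c; apply: differentiableZ.
    exact: differentiable_coord.
  by apply/funext => z; rewrite fct_sumE.
have -> : f = g + (fun y : 'rV[R]_n => \sum_(c < n) pd c f x *: (y 0 c)).
  by apply/funext => y; rewrite /g !fctE subrK.
apply: differentiableD => //.
have dcoord y a c : is_derive y (basis_vec R a)
    (fun y : 'rV[R]_n => y 0 c : R) (a == c)%:R.
  split; first exact/diff_derivable/differentiable_coord.
  apply: cvg_lim => //; apply: cvg_near_cst; near=> h.
  rewrite /= !mxE eqxx/= addrK [c == a]eq_sym -mulr_natr.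
  by rewrite -[LHS]/(_ * _) mulrA mulVf ?mul1r//; near: h; exact: nbhs_dnbhs_neq.
have dLa y a : is_derive y (basis_vec R a)
    (fun y : 'rV[R]_n => \sum_(c < n) pd c f x *: (y 0 c)) (pd a f x).
  rewrite (_ : (fun _ => _) = \sum_(c < n) (pd c f x \*: (fun y : 'rV[R]_n => y 0 c : R))).
    apply: is_derive_eq.
    rewrite (bigD1 a)//= eqxx [_ *: _]mulr1 big1 ?addr0// => c /negPf ca.
    by rewrite eq_sym ca [_ *: _]mulr0.
  by apply/funext => z; rewrite fct_sumE.
have dg y a : U y -> is_derive y (basis_vec R a) g (pd a f y - pd a f x).
  move=> Uy; apply: is_deriveB; apply: derivableP.
  exact: Cp_derivable Cf _ _.
apply: differentiable_flat => e e0.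
pose d := e / n.+1%:R.
have d0 : 0 < d by rewrite divr_gt0.
have : \forall y \near x, U y /\ forall a, `|pd a f y - pd a f x| <= d.
  apply: filterI; first exact: near_of_open.
  have near_a (a : 'I_n) : \forall y \near x, `|pd a f y - pd a f x| <= d.
    have /cvgrPdist_le/(_ d d0) := Cp_continuous (Cp_pd Cf (erefl : a \in predT)) Ux.
    by apply: filterS => y; rewrite distrC.
  exact: (filter_forall (nbhs_filter x) near_a).
move=> /nbhs_ballP[r /= r0 Hr].
have dr : \forall h \near (0 : 'rV[R]_n), `|h| < r by exact: nbhs0_lt.
apply: filterS dr => h hr.
apply: le_trans (@increment_bound g U x r d _ _ _ _ h hr) _.
- by move=> y /Hr[].
- exact: ltW.
- by move=> a y /(dg _ a)[].
- by move=> a y /Hr[Uy]; have [_ ->] := dg y a Uy; exact.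
rewrite ler_wpM2r// /d mulrCA ler_piMr//; first exact: ltW.
by rewrite ler_pdivrMr// mul1r ler_nat.
Unshelve. all: by end_near. Qed.

End criterion.

(** * Chain rule, symmetry of second derivatives, comparison with Ck *)

Section chain.
Context {R : realType}.

Lemma continuous_rV (T : topologicalType) m (g : T -> 'rV[R]_m) (x : T) :
  (forall b, {for x, continuous (fun y => g y 0 b)}) -> {for x, continuous g}.
Proof.
move=> cg; apply/cvgrPdist_le => e e0.
have near_b (b : 'I_m) : \forall y \near x, `|g x 0 b - g y 0 b| <= e.
  by have /cvgrPdist_le/(_ e e0) := cg b.
have := filter_forall (nbhs_filter x) near_b; apply: filterS => y Hy.
by apply: norm_rV_le; [exact: ltW|move=> b; rewrite !mxE].
Qed.

Lemma continuous_coord (T : topologicalType) m (g : T -> 'rV[R]_m) (x : T) b :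
  {for x, continuous g} -> {for x, continuous (fun y => g y 0 b)}.
Proof.
by move=> cg; exact: (continuous_comp cg (@coord_continuous R 1 m 0 b (g x))).
Qed.

Lemma rV_sum m (v : 'rV[R]_m) : v = \sum_(b < m) v 0 b *: basis_vec R b.
Proof. exact: row_sum_delta. Qed.

Lemma differentiable_rV (V : normedModType R) m (g : V -> 'rV[R]_m) (x : V) :
  (forall b, differentiable (fun y => g y 0 b) x) -> differentiable g x.
Proof.
move=> dg; rewrite (_ : g = \sum_(b < m) (fun y => g y 0 b *: basis_vec R b)).
  by apply: differentiable_sum => b; exact: differentiableZl.
by apply/funext => y; rewrite fct_sumE -rV_sum.
Qed.

Lemma differentiable_component (V : normedModType R) m (g : V -> 'rV[R]_m) (x : V) b :
  differentiable g x -> differentiable (fun y => g y 0 b) x.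
Proof.
by move=> dg; apply: (@differentiable_comp _ _ _ _ g (fun v => v 0 b)) => //;
  exact: differentiable_coord.
Qed.

Lemma derive_component (V : normedModType R) m (g : V -> 'rV[R]_m) (x v : V) b :
  derivable g x v -> 'D_v (fun y => g y 0 b) x = ('D_v g x) 0 b.
Proof. by move=> dg; rewrite derive_mx// mxE. Qed.

Lemma is_derive_comp n m (f : 'rV[R]_m -> R) (g : 'rV[R]_n -> 'rV[R]_m) x a :
  differentiable f (g x) -> differentiable g x ->
  is_derive x (basis_vec R a) (f \o g)
    (\sum_(b < m) pd b f (g x) * pd a (fun y => g y 0 b) x).
Proof.
move=> df dg; have dfg := differentiable_comp dg df.
split; first exact: diff_derivable.
rewrite deriveE// diff_comp//= -(deriveE _ dg).
rewrite [X in 'd f (g x) X]rV_sum linear_sum/=; apply: eq_bigr => b _.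
rewrite linearZ/= -deriveE// mulrC derive_component//.
exact: diff_derivable.
Qed.

Lemma Cp_differentiable_rV n m U k (g : 'rV[R]_n -> 'rV[R]_m) x :
  open U -> U x -> (forall b, Cp predT k.+1 U (fun y => g y 0 b)) ->
  differentiable g x.
Proof.
move=> oU Ux Cg; apply: differentiable_rV => b.
by apply: (Cp_differentiable oU Ux); exact: Cp_le (Cg b).
Qed.

Lemma Cp_comp n m k (U : set 'rV[R]_n) (W : set 'rV[R]_m) (f : 'rV[R]_m -> R) (g : 'rV[R]_n -> 'rV[R]_m) :
  open U -> open W -> (forall x, U x -> W (g x)) ->
  (forall b, Cp predT k U (fun y => g y 0 b)) -> Cp predT k W f ->
  Cp predT k U (f \o g).
Proof.
move=> oU oW UW; elim: k f => [|k IH] f Cg Cf.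
  split => // x Ux; apply: continuous_comp.
    by apply: continuous_rV => b; exact: Cp_continuous (Cg b) Ux.
  exact: Cp_continuous Cf (UW _ Ux).
have dfg x a : U x -> is_derive x (basis_vec R a) (f \o g)
    (\sum_(b < m) pd b f (g x) * pd a (fun y => g y 0 b) x).
  move=> Ux; apply: is_derive_comp; last exact: Cp_differentiable_rV Cg.
  by apply: (Cp_differentiable oW (UW _ Ux)); exact: Cp_le Cf.
have IH' := IH _ (fun b => CpS (Cg b)).
split => [x Ux|a _].
  exact: Cp_continuous (IH' f (CpS Cf)) Ux.
split; first by move=> x /(dfg _ a)[].
apply: (@Cp_eq _ _ _ _ _
  (fun x => \sum_(b < m) (pd b f \o g) x * pd a (fun y => g y 0 b) x)) => //.
  by move=> x; rewrite inE => /(dfg _ a)[_ ->].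
apply: Cp_sum => // b _; apply: CpM => //; last exact: Cp_pd (Cg b) _.
by apply: IH'; exact: Cp_pd Cf _.
Qed.

(** The second difference of [f] along [h e_c] and [h e_d] does not depend on
    the order of the two increments. By the mean value theorem it is h^2 times
    the value of either mixed derivative at some point close to [x]; let h tend
    to 0 and use the continuity of both mixed derivatives. *)
Lemma pd_commute n (U : set 'rV[R]_n) k (f : 'rV[R]_n -> R) a b (x : 'rV[R]_n) :
  open U -> U x -> Cp predT k.+2 U f ->
  pd a (pd b f) x = pd b (pd a f) x.
Proof.
move=> oU Ux /(@Cp_le _ _ predT 2 _ _ _ (isT : (2 <= k.+2)%N)) Cf.
have second c d h : (forall y, `|y - x| <= h + h -> U y) -> 0 <= h ->
  exists2 y, `|y - x| <= h + h &
    f (x + h *: basis_vec R c + h *: basis_vec R d) - f (x + h *: basis_vec R d)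
     - (f (x + h *: basis_vec R c) - f x)
    = h * (h * pd c (pd d f) y).
  move=> xU h0.
  have hv (t : R) (e : 'I_n) : `|t| <= h -> `|t *: basis_vec R e| <= h.
    move=> th; rewrite normrZ -[leRHS]mulr1 ler_pM//.
    exact: norm_basis_vec.
  have near1 (t : R) (e : 'I_n) : `|t| <= h -> U (x + t *: basis_vec R e).
    move=> /hv th; apply: xU; rewrite addrAC subrr add0r.
    by rewrite (le_trans (th _))// lerDl.
  have near2 (s t : R) (e e' : 'I_n) : `|s| <= h -> `|t| <= h ->
      U (x + s *: basis_vec R e + t *: basis_vec R e').
    move=> /hv sh /hv th; apply: xU; rewrite addrAC [x + _ - x]addrAC subrr add0r.
    by rewrite (le_trans (ler_normD _ _))// lerD.
  pose g y := f (y + h *: basis_vec R c) - f y.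
  have dg (t : R) : `|t| <= h -> is_derive (x + t *: basis_vec R d) (basis_vec R d) g
      (pd d f (x + t *: basis_vec R d + h *: basis_vec R c) -
       pd d f (x + t *: basis_vec R d)).
    move=> th; apply: is_deriveB; last first.
      apply: derivableP; apply: Cp_derivable Cf _ _ => //; exact: near1.
    apply: line_is_derive.
    rewrite (_ : (fun _ => _) = (fun s : R => f (x + t *: basis_vec R d +
       h *: basis_vec R c + s *: basis_vec R d))); last first.
      by apply/funext => s; congr f; rewrite addrAC.
    have := @is_derive_line _ _ f (x + t *: basis_vec R d +
       h *: basis_vec R c) (basis_vec R d) 0; rewrite scale0r addr0; apply.
    by apply: Cp_derivable Cf _ _ => //; apply: near2 => //; rewrite ger0_norm.
  have [t|s] := @MVT_line _ _ g x (basis_vec R d) h.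
    by rewrite (ger0_norm h0) => /dg[].
  rewrite (ger0_norm h0) => sh.
  have [_ ->] := dg s sh.
  have [t|t] := @MVT_line _ _ (pd d f) (x + s *: basis_vec R d) (basis_vec R c) h.
    rewrite (ger0_norm h0) => th.
    by apply: Cp_derivable (Cp_pd Cf _) _ _ => //; exact: near2.
  rewrite (ger0_norm h0) => th -> E.
  exists (x + s *: basis_vec R d + t *: basis_vec R c).
    rewrite addrAC [x + _ - x]addrAC subrr add0r (le_trans (ler_normD _ _))//.
    by rewrite lerD// hv.
  by rewrite -E /g; congr (f _ - _ - _); rewrite addrAC.
have cont c d : {for x, continuous (pd c (pd d f))}.
  by apply: Cp_continuous (Cp_pd (Cp_pd Cf _) _) Ux.
apply/eqP; rewrite -subr_eq0 -normr_le0; apply/ler_addgt0Pr => e e0.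
have e20 : 0 < e / 2 by rewrite divr_gt0.
have /cvgrPdist_le/(_ _ e20) nab := cont a b.
have /cvgrPdist_le/(_ _ e20) nba := cont b a.
have : \forall y \near x, U y /\ (`|pd a (pd b f) x - pd a (pd b f) y| <= e / 2 /\
    `|pd b (pd a f) x - pd b (pd a f) y| <= e / 2).
  exact: filterI (near_of_open oU Ux) (filterI nab nba).
move=> /nbhs_ballP[r /= r0 Hr].
(* Each intermediate point is within [h + h] of [x], hence in the ball of
   radius [r]. *)
pose h := r / 4.
have h0 : 0 < h by rewrite divr_gt0.
have hr y : `|y - x| <= h + h -> ball x r y.
  move=> yx; rewrite -ball_normE /= distrC (le_lt_trans yx)//.
  by rewrite /h; lra.
have hU y : `|y - x| <= h + h -> U y by move=> /hr/Hr[].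
have [y /hr/Hr[_ [yab _]] Ey] := second a b h hU (ltW h0).
have [z /hr/Hr[_ [_ zba]] Ez] := second b a h hU (ltW h0).
have yz : pd a (pd b f) y = pd b (pd a f) z.
  apply: (mulfI (lt0r_neq0 h0)); apply: (mulfI (lt0r_neq0 h0)).
  rewrite -Ey -Ez [x + _ + _]addrAC.
  move: (f _) (f _) (f _) (f _) => p q s t; ring.
move: yz yab zba; move: (pd a (pd b f) x) (pd b (pd a f) x) => p q.
move: (pd a (pd b f) y) (pd b (pd a f) z) => s t -> pt qt.
rewrite add0r -(subrKA t) (splitr e) (le_trans (ler_normD _ _))// lerD//.
by rewrite distrC.
Qed.

End chain.

Section Ck_Cp.
Context {R : realType} {n : nat}.

Lemma Ck_Cp m k U (F : 'rV[R]_n -> 'rV[R]_m) b : open U ->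
  Ck k U F -> Cp predT k U (fun x => F x 0 b).
Proof.
move=> oU; elim: k F => [|k IH] F /=.
  by move=> cF; split => // x Ux; apply: continuous_coord; exact: cF.
move=> [dF CF]; split => [x Ux|a _].
  by apply: continuous_coord; apply: differentiable_continuous; exact: dF.
split.
  move=> x Ux; apply: diff_derivable; apply: differentiable_component.
  exact: dF.
apply: Cp_eq (IH _ (CF a)) => // x; rewrite inE => Ux.
by rewrite derive_component//; apply: diff_derivable; exact: dF.
Qed.

Lemma Cp_Ck m k U (F : 'rV[R]_n -> 'rV[R]_m) : open U ->
  (forall b, Cp predT k U (fun x => F x 0 b)) -> Ck k U F.
Proof.
move=> oU; elim: k F => [|k IH] F CF /=.
  by move=> x Ux; apply: continuous_rV => b; exact: Cp_continuous (CF b) Ux.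
have dF x : U x -> differentiable F x.
  by move=> Ux; exact: Cp_differentiable_rV CF.
split => // a; apply: IH => b.
apply: Cp_eq (Cp_pd (CF b) (erefl : a \in predT)) => // x; rewrite inE => Ux.
by rewrite derive_component//; apply: diff_derivable; exact: dF.
Qed.

Lemma Ck_Cp_scalar k U (f : 'rV[R]_n -> R^o) : Ck k U f -> Cp predT k U f.
Proof.
elim: k f => [|k IH] f //= [df Cf].
split => [x Ux|a _]; first by apply: differentiable_continuous; exact: df.
split; last exact: IH (Cf a).
by move=> x Ux; apply: diff_derivable; exact: df.
Qed.

End Ck_Cp.

(** * Smooth functions of one variable *)

Section smooth_line.
Context {R : realType}.
Implicit Types w : R -> R.

Fixpoint Cline (k : nat) w : Prop :=
  continuous w /\
  if k is k'.+1 then (forall t : R, derivable w t 1) /\ Cline k' (derive1 w) else True.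

Definition smooth_line w := forall k, Cline k w.

Lemma ClineS k w : Cline k.+1 w -> Cline k w.
Proof.
elim: k w => [|k IH] w /= [cw [dw Cw]]; split => //; split => //.
exact: IH.
Qed.

Lemma Cline_cst k (c : R) : Cline k (fun=> c).
Proof.
elim: k c => [|k IH] c /=; split => //; try exact: cst_continuous.
split => [t|]; first exact: derivable_cst.
rewrite (_ : derive1 _ = fun=> 0); first exact: IH.
by apply/funext => t; rewrite derive1E derive_cst.
Qed.

Lemma ClineD k w w' : Cline k w -> Cline k w' -> Cline k (fun t => w t + w' t).
Proof.
elim: k w w' => [|k IH] w w' /= [cw dw] [cw' dw'].
  by split => // t; exact: (cvgD (cw t) (cw' t)).
have [ddw Cw] := dw; have [ddw' Cw'] := dw'.
split; first by move=> t; exact: (cvgD (cw t) (cw' t)).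
split; first by move=> t; exact: derivableD.
rewrite (_ : derive1 _ = fun t => (derive1 w) t + (derive1 w') t); first exact: IH.
by apply/funext => t; rewrite !derive1E deriveD.
Qed.

Lemma ClineM k w w' : Cline k w -> Cline k w' -> Cline k (fun t => w t * w' t).
Proof.
elim: k w w' => [|k IH] w w'.
  move=> [cw _] [cw' _]; split => // t; exact: (cvgM (cw t) (cw' t)).
move=> Cw Cw'; have := Cw => -[cw [dw Dw]]; have := Cw' => -[cw' [dw' Dw']].
split; first by move=> t; exact: (cvgM (cw t) (cw' t)).
split; first by move=> t; exact: derivableM.
rewrite (_ : derive1 _ = fun t => w t * (derive1 w') t + w' t * (derive1 w) t).
  by apply: ClineD; apply: IH => //; exact: ClineS.
by apply/funext => t; rewrite !derive1E (@deriveM _ _ w w').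
Qed.

Lemma ClineV k w : (forall t, w t != 0) -> Cline k w ->
  Cline k (fun t => (w t)^-1).
Proof.
move=> w0; elim: k => [[cw _]|k IH].
  by split => // t; exact: (cvgV (w0 t) (cw t)).
move=> Cw; have := Cw => -[cw [dw Dw]].
split; first by move=> t; exact: (cvgV (w0 t) (cw t)).
split; first by move=> t; exact: derivableV.
have Cwk := IH (ClineS Cw).
rewrite (_ : derive1 _ = fun t => (-1 * ((w t)^-1 * (w t)^-1)) * (derive1 w) t).
  by apply: ClineM => //; apply: ClineM; [exact: Cline_cst|exact: ClineM].
apply/funext => t; rewrite !derive1E (@deriveV _ _ w)//.
by rewrite -[LHS]/(- (w t) ^- 2 * _) expr2 invfM mulN1r.
Qed.

Lemma Cline_affine k w (a b : R) : Cline k w -> Cline k (fun t => w (a * t + b)).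
Proof.
have daff (t : R) : is_derive t 1 (fun t : R => a * t + b) a.
  rewrite (_ : (fun _ => _) = a \*: (@id R) + cst b)//.
  by apply: is_derive_eq; rewrite addr0 [_ *: _]mulr1.
have caff : continuous (fun t : R => a * t + b).
  by move=> t; have [/derivable1_diffP/differentiable_continuous] := daff t.
elim: k w => [|k IH] w /= [cw dw].
  split => // t; exact: continuous_comp (caff t) (cw _).
have [ddw Cw] := dw.
have dwt (t : R) : is_derive t 1 (w \o (fun t : R => a * t + b)) ((derive1 w) (a * t + b) * a).
  by apply: is_derive1_comp; rewrite derive1E; exact: derivableP.
split; first by move=> t; exact: continuous_comp (caff t) (cw _).
split; first by move=> t; have [] := dwt t.
rewrite (_ : derive1 _ = fun t => (derive1 w) (a * t + b) * a).
  by apply: ClineM; [exact: IH|exact: Cline_cst].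
by apply/funext => t; rewrite derive1E; have [_] := dwt t.
Qed.

(** The functions t^-k exp(-1/t), extended by 0 to t <= 0. The whole family is
    considered at once because it is stable under derivation up to linear
    combinations, which makes smoothness an induction on the order. *)
Definition flat_exp (k : nat) (t : R) : R :=
  if 0 < t then t ^- k * expR (- t^-1) else 0.

(** A quadratic bound at 0 gives a zero derivative there. It follows from
    exp(1/t) >= t^-(k+2) / (k+2)! for t > 0. *)
Lemma flat_exp_bound k (t : R) : `|flat_exp k t| <= k.+2`!%:R * `|t| * `|t|.
Proof.
rewrite /flat_exp; case: ifPn => [t0|_]; last by rewrite normr0 !mulr_ge0.
have ti0 : 0 < t^-1 by rewrite invr_gt0.
rewrite ger0_norm; last by rewrite mulr_ge0 ?expR_ge0// invr_ge0 exprn_ge0// ltW.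
rewrite gtr0_norm// expRN ler_pdivrMr ?expR_gt0//.
have f0 : 0 < k.+2`!%:R :> R by rewrite ltr0n fact_gt0.
have : t^-1 ^+ k.+2 / k.+2`!%:R <= expR t^-1.
  by apply: le_trans (expR_ge1Dxn k.+1 (ltW ti0)); rewrite lerDr.
rewrite ler_pdivrMr// => H.
have : t ^- k = t ^+ 2 * t^-1 ^+ k.+2.
  by rewrite exprVn -(addn2 k) (exprD t k 2) invfM mulrCA divff ?mulr1// expf_neq0// gt_eqF.
move=> ->; apply: (@le_trans _ _ (t ^+ 2 * (expR t^-1 * k.+2`!%:R))).
  by rewrite ler_wpM2l// exprn_ge0// ltW.
rewrite expr2; move: (expR _) (_%:R) => p q; rewrite le_eqVlt; apply/orP; left.
by apply/eqP; ring.
Qed.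

(** Away from 0 this is a computation with the usual rules; at 0 both sides
    vanish, by [flat_exp_bound]. *)
Lemma is_derive_flat_exp k (t : R) :
  is_derive t 1 (flat_exp k) (- k%:R * flat_exp k.+1 t + flat_exp k.+2 t).
Proof.
have [t0|t0|<-] := ltgtP 0 t.
- have tn0 : t != 0 by rewrite gt_eqF.
  have E : \near t, t ^- k * expR (- t^-1) = flat_exp k t.
    by near=> s; rewrite /flat_exp ifT//; near: s; exact: lt_nbhsr.
  apply: (near_eq_is_derive E).
  rewrite /flat_exp t0.
  have dV : is_derive t 1 (fun s : R => s^-1) (- t ^- 2).
    apply: is_derive_eq; first exact: (is_deriveV tn0 (is_derive_id t 1)).
    by rewrite [_ *: _]mulr1.
  have dVk : is_derive t 1 (fun s : R => s ^- k) (- k%:R * t ^- k.+1).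
    rewrite (_ : (fun _ => _) = (fun s : R => s^-1) ^+ k); last first.
      by apply/funext => s; rewrite fctE exprVn.
    apply: is_derive_eq.
    rewrite -[LHS]/(k%:R * t^-1 ^+ k.-1 * - t ^- 2).
    case: k {E} => [|k]; first by rewrite mulr0n !mul0r oppr0 mul0r.
    rewrite /= mulrN mulNr -mulrA; congr (- (_ * _)).
    by rewrite -!exprVn -exprD addn2.
  have dE : is_derive t 1 (expR \o (fun s : R => - s^-1)) (expR (- t^-1) * t ^- 2).
    have dN : is_derive t 1 (fun s : R => - s^-1) (t ^- 2).
      by have := is_deriveN dV; rewrite opprK.
    exact: (@is_derive1_comp _ expR (fun s : R => - s^-1) t _ _ (is_derive_expR _) dN).
  have dM := is_deriveM dVk dE.
  apply: (is_derive_eq dM).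
  rewrite -[LHS]/(t ^- k * (expR (- t^-1) / t ^+ 2) +
    expR (- t^-1) * (- k%:R / t ^+ k.+1)).
  have -> : t ^- k.+2 = t ^- k / t ^+ 2 by rewrite -!exprVn -exprD addn2.
  move: (expR _) (t ^- k) (t ^+ 2)^-1 (t ^- k.+1) (k%:R) => p q r s u; ring.
- have E : \near t, 0 = flat_exp k t.
    near=> s; rewrite /flat_exp ifF//; apply/negbTE; rewrite -leNgt.
    by apply: ltW; near: s; exact: lt_nbhsl.
  apply: (near_eq_is_derive E); apply: is_derive_eq.
  by rewrite /flat_exp (ltNge 0 t) (ltW t0)/= mulr0 addr0.
- have f0 j : flat_exp j 0 = 0 by rewrite /flat_exp ltxx.
  rewrite !f0 mulr0 addr0.
  suff H : (fun h : R => h^-1 *: ((flat_exp k \o shift 0) (h *: 1) - flat_exp k 0))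
      @ 0^' --> (0 : R).
    by split; [apply/cvg_ex; exists 0|exact: cvg_lim].
  apply/cvgrPdist_le => e e0.
  pose C : R := k.+2`!%:R.
  have C0 : 0 < C by rewrite ltr0n fact_gt0.
  near=> h.
  have h0 : h != 0 by near: h; exact: nbhs_dnbhs_neq.
  have he : `|h| < e / C by near: h; apply: dnbhs0_lt; rewrite divr_gt0.
  rewrite f0 sub0r normrN subr0 /= addr0 [h *: 1]mulr1 normrZ normfV.
  rewrite ler_pdivrMl ?normr_gt0//.
  apply: (le_trans (flat_exp_bound k h)); rewrite -/C.
  rewrite [leRHS]mulrC ler_wpM2r//.
  by rewrite mulrC -ler_pdivlMr// ltW.
Unshelve. all: by end_near. Qed.

Lemma smooth_flat_exp k : smooth_line (flat_exp k).
Proof.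
have cE j : continuous (flat_exp j).
  by move=> t; have [/derivable1_diffP/differentiable_continuous] := is_derive_flat_exp j t.
move=> m; elim: m k => [|m IH] k; first by split.
split => //; split; first by move=> t; have [] := is_derive_flat_exp k t.
rewrite (_ : derive1 _ = fun t => - k%:R * flat_exp k.+1 t + flat_exp k.+2 t).
  by apply: ClineD => //; apply: ClineM => //; exact: Cline_cst.
by apply/funext => t; rewrite derive1E; have [_] := is_derive_flat_exp k t.
Qed.

(** Of the two terms of the denominator one is positive, whatever [t] is: no
    division by zero occurs, and the quotient is 0 for t <= 0 and 1 for
    t >= 1. *)
Definition smooth_step (t : R) : R :=
  flat_exp 0 t / (flat_exp 0 t + flat_exp 0 (1 - t)).

Lemma flat_exp_gt0 (t : R) : 0 < t -> 0 < flat_exp 0 t.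
Proof. by move=> t0; rewrite /flat_exp t0 expr0 invr1 mul1r expR_gt0. Qed.

Lemma flat_exp_ge0 (t : R) : 0 <= flat_exp 0 t.
Proof.
by have [/flat_exp_gt0/ltW//|t0] := ltP 0 t; rewrite /flat_exp ltNge t0.
Qed.

Lemma smooth_step_denom (t : R) : 0 < flat_exp 0 t + flat_exp 0 (1 - t).
Proof.
have [t0|t0] := ltP 0 t.
  by rewrite ltr_wpDr ?flat_exp_ge0 ?flat_exp_gt0.
by rewrite ltr_wpDl ?flat_exp_ge0// flat_exp_gt0// subr_gt0 (le_lt_trans t0).
Qed.

Lemma smooth_smooth_step : smooth_line smooth_step.
Proof.
move=> k; apply: ClineM; first exact: smooth_flat_exp.
apply: ClineV => [t|]; first by rewrite gt_eqF// smooth_step_denom.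
apply: ClineD; first exact: smooth_flat_exp.
rewrite (_ : (fun _ => _) = (fun t => flat_exp 0 (-1 * t + 1))).
  by apply: Cline_affine; exact: smooth_flat_exp.
by apply/funext => t; rewrite mulN1r addrC.
Qed.

Lemma smooth_step0 (t : R) : t <= 0 -> smooth_step t = 0.
Proof. by move=> t0; rewrite /smooth_step /flat_exp ltNge t0 mul0r. Qed.

Lemma smooth_step1 (t : R) : 1 <= t -> smooth_step t = 1.
Proof.
move=> t1; have f0 : flat_exp 0 (1 - t) = 0.
  by rewrite /flat_exp subr_gt0 ltNge t1.
have := smooth_step_denom t; rewrite /smooth_step f0 addr0 => d.
by rewrite divff// gt_eqF.
Qed.


Lemma Cp_line n (S : {pred 'I_n}) k U w (a b : R) (c : 'I_n) : smooth_line w ->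
  Cp S k U (fun x : 'rV[R]_n => w (a * x 0 c + b)).
Proof.
have ccoord : continuous (fun x : 'rV[R]_n => a * x 0 c + b).
  move=> x.
  exact: (cvgD (cvgM (cvg_cst a) (@coord_continuous R 1 n 0 c x)) (cvg_cst b)).
elim: k w => [|k IH] w sw.
  by split => // x _; exact: continuous_comp (ccoord x) ((sw 0%N).1 _).
split; first by move=> x _; exact: continuous_comp (ccoord x) ((sw 0%N).1 _).
have dw (t : R) : is_derive t 1 w (derive1 w t).
  by rewrite derive1E; apply: derivableP; exact: (sw 1%N).2.1.
move=> j _.
have dwj x : is_derive x (basis_vec R j) (fun x : 'rV[R]_n => w (a * x 0 c + b))
    ((a * (j == c)%:R) * derive1 w (a * x 0 c + b)).
  apply: line_is_derive.
  rewrite (_ : (fun _ => _) = w \o (fun s : R => a * (j == c)%:R * s + (a * x 0 c + b))).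
    have dl : is_derive (0 : R) 1 (fun s : R => a * (j == c)%:R * s + (a * x 0 c + b))
        (a * (j == c)%:R).
      rewrite (_ : (fun _ => _) = (a * (j == c)%:R) \*: (@id R) + cst (a * x 0 c + b))//.
      by apply: is_derive_eq; rewrite addr0 [_ *: _]mulr1.
    have := @is_derive1_comp _ w _ 0 _ _ (dw (a * (j == c)%:R * 0 + (a * x 0 c + b))) dl.
    by rewrite mulr0 add0r [X in is_derive _ _ _ X]mulrC.
  apply/funext => s /=; congr w; rewrite !mxE eqxx/= [c == j]eq_sym.
  by rewrite mulrDr addrAC addrC; congr (_ + _); rewrite -mulrA [s * _]mulrC.
split; first by move=> x _; have [] := dwj x.
rewrite (_ : pd j _ = fun x : 'rV[R]_n =>
    (fun t => (a * (j == c)%:R) * derive1 w t) (a * x 0 c + b)); last first.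
  by apply/funext => x; have [_] := dwj x.
apply: (IH (fun t => a * (j == c)%:R * derive1 w t)) => m.
apply: ClineM; first exact: Cline_cst.
exact: (sw m.+1).2.2.
Qed.

End smooth_line.

(** * Weighted averages along segments *)

Section integral01.
Context {R : realType}.
Implicit Types (g : R -> R).

Definition cont01 g := forall t : R, 0 <= t <= 1 -> {for t, continuous g}.

Definition I01 g : R := \int[lebesgue_measure]_(t in `[0 : R, 1]) g t.

Lemma cont01_integrable g : cont01 g ->
  lebesgue_measure.-integrable `[0 : R, 1] (EFin \o g).
Proof.
move=> cg; apply: continuous_compact_integrable; first exact: segment_compact.
by apply: continuous_in_subspaceT => t; rewrite inE/= in_itv/= => /cg.
Qed.

Lemma I01D g h : cont01 g -> cont01 h -> I01 (fun t => g t + h t) = I01 g + I01 h.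
Proof. by move=> cg ch; rewrite /I01 RintegralD//; exact: cont01_integrable. Qed.

Lemma I01Z (c : R) g : cont01 g -> I01 (fun t => c * g t) = c * I01 g.
Proof. by move=> cg; rewrite /I01 RintegralZl//; exact: cont01_integrable. Qed.

Lemma cont01Z (c : R) g : cont01 g -> cont01 (fun t => c * g t).
Proof. by move=> cg t /cg ct; exact: (cvgM (cvg_cst c) ct). Qed.

Lemma cont01B g h : cont01 g -> cont01 h -> cont01 (fun t => g t - h t).
Proof. by move=> cg ch t t01; exact: (cvgB (cg t t01) (ch t t01)). Qed.

Lemma I01B g h : cont01 g -> cont01 h -> I01 (fun t => g t - h t) = I01 g - I01 h.
Proof. by move=> cg ch; rewrite /I01 RintegralB//; exact: cont01_integrable. Qed.

Lemma eq_I01 g h : (forall t, 0 <= t <= 1 -> g t = h t) -> I01 g = I01 h.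
Proof. by move=> gh; apply: eq_Rintegral => t; rewrite inE/= in_itv/= => /gh. Qed.

Lemma I01_FTC (G g : R -> R) :
  (forall t : R, 0 <= t <= 1 -> is_derive t 1 G (g t)) -> cont01 g ->
  I01 g = G 1 - G 0.
Proof.
move=> dG cg.
have cG t : 0 <= t <= 1 -> {for t, continuous G}.
  by move=> /dG[/derivable1_diffP/differentiable_continuous].
rewrite /I01 /Rintegral (@continuous_FTC2 _ g G)//.
- by apply: continuous_in_subspaceT => t; rewrite inE/= in_itv/= => /cg.
- split.
  + move=> t; rewrite in_itv/= => /andP[t0 t1].
    have t01 : 0 <= t <= 1 by rewrite !ltW.
    by have [] := dG t t01.
  + by apply: cvg_at_right_filter; apply: cG; rewrite lexx ler01.
  + by apply: cvg_at_left_filter; apply: cG; rewrite lexx ler01.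
- move=> t; rewrite in_itv/= => /andP[t0 t1]; rewrite derive1E.
  have t01 : 0 <= t <= 1 by rewrite !ltW.
  by have [_ ->] := dG t t01.
Qed.

Lemma I01_cst (c : R) : I01 (fun=> c) = c.
Proof.
have d (t : R) : 0 <= t <= 1 -> is_derive t 1 (c \*: (@id R)) c.
  by move=> _; apply: is_derive_eq; rewrite [_ *: _]mulr1.
have cc : cont01 (fun=> c) by move=> t _; exact: cst_continuous.
have -> := I01_FTC d cc.
by rewrite -[LHS]/(c * 1 - c * 0) mulr1 mulr0 subr0.
Qed.

Lemma I01_bound g (e : R) : cont01 g -> (forall t, 0 <= t <= 1 -> `|g t| <= e) ->
  `|I01 g| <= e.
Proof.
move=> cg ge; apply: le_trans.
  by apply: le_normr_Rintegral => //; exact: cont01_integrable.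
have cn : cont01 (fun t => `|g t|).
  by move=> t /cg ct; exact: (cvg_norm ct).
have cc : cont01 (fun=> e) by move=> t _; exact: cst_continuous.
apply: (@le_trans _ _ (I01 (fun=> e))).
  apply: (le_Rintegral _ (cont01_integrable cn) (cont01_integrable cc)).
    by [].
  by move=> t; rewrite /= in_itv/= => /ge.
by rewrite I01_cst.
Qed.

End integral01.

Section averages.
Context {R : realType} {V : normedModType R}.
Implicit Types (w : R -> R) (e : V) (f : V -> R) (x : V) (U : set V).

(** The average of [f] on the segment from [x] to [x + e], with weight [w]. It is
    a convolution of [f] in the direction [e] only, so that it makes sense as
    soon as the segment lies in the domain of [f], and [e] can be taken short
    enough for that. *)
Definition lineavg w e f x : R := I01 (fun u => w u * f (x + u *: e)).

Definition segment_in e U x := forall u : R, 0 <= u <= 1 -> U (x + u *: e).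

Lemma cont01_seg w e f U x : continuous w ->
  (forall y, U y -> {for y, continuous f}) -> segment_in e U x ->
  cont01 (fun u => w u * f (x + u *: e)).
Proof.
move=> cw cf xU u u01; apply: cvgM; first exact: cw.
have cl : {for u, continuous (fun u : R => x + u *: e)}.
  apply: cvgD; first exact: cvg_cst.
  by apply: cvgZl; exact: cvg_id.
exact: (continuous_comp cl (cf _ (xU u u01))).
Qed.

Lemma compact01 : compact [set u : R | 0 <= u <= 1].
Proof.
rewrite (_ : [set _ | _] = `[0, 1]%classic); first exact: segment_compact.
by apply/seteqP; split => u /=; rewrite in_itv.
Qed.

(** The tube lemma: the parameters of the segment form a compact set. *)
Lemma near_segment e (P : R -> V -> Prop) x :
  (forall u : R, 0 <= u <= 1 -> \forall p \near (u, x + u *: e), P p.1 p.2) ->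
  \forall q \near (x, e), forall u : R, 0 <= u <= 1 -> P u (q.1 + u *: q.2).
Proof.
move=> H.
have /compact_near_coveringP/(_ _ (nbhs (x, e))
  (fun q u => P u (q.1 + u *: q.2))) := compact01; apply.
move=> u /H Pu.
have : (fun p : R * (V * V) => (p.1, p.2.1 + p.1 *: p.2.2)) @ (u, (x, e)) -->
    (u, x + u *: e).
  have c1 : (fun p : R * (V * V) => p.1) @ (u, (x, e)) --> u by exact: cvg_fst.
  have c2 : (fun p : R * (V * V) => p.2) @ (u, (x, e)) --> (x, e) by exact: cvg_snd.
  have c21 : (fun p : R * (V * V) => p.2.1) @ (u, (x, e)) --> x.
    exact: (cvg_comp _ _ c2 cvg_fst).
  have c22 : (fun p : R * (V * V) => p.2.2) @ (u, (x, e)) --> e.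
    exact: (cvg_comp _ _ c2 cvg_snd).
  exact: (cvg_pair c1 (cvgD c21 (cvgZ c1 c22))).
by move=> /(_ _ Pu).
Qed.

Lemma near_segment_in e U x : open U -> segment_in e U x ->
  \forall q \near (x, e), segment_in q.2 U q.1.
Proof.
move=> oU xU; apply: (@near_segment e (fun=> U)) => u /xU Uu.
have : (fun p : R * V => p.2) @ (u, x + u *: e) --> x + u *: e by exact: cvg_snd.
by apply; exact: open_nbhs_nbhs.
Qed.

Lemma bound01 (w : R -> R) : cont01 w ->
  exists2 M : R, 0 < M & forall u, 0 <= u <= 1 -> `|w u| <= M.
Proof.
move=> cw; have [|c _ Hc] := @EVT_max R (fun u => `|w u|) 0 1 ler01.
  apply: continuous_in_subspaceT => t; rewrite inE/= in_itv/= => /cw ct.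
  exact: (cvg_norm ct).
exists (`|w c| + 1); first by rewrite ltr_wpDl.
move=> u u01; apply: (@le_trans _ _ `|w c|); last by rewrite lerDl.
by apply: Hc; rewrite in_itv.
Qed.

(** Continuity along a compact segment is uniform, also with respect to a
    displacement of the segment. *)
Lemma near_uniform e f U x (d : R) : open U ->
  (forall y, U y -> {for y, continuous f}) -> segment_in e U x -> 0 < d ->
  \forall q \near (x, e), forall u : R, 0 <= u <= 1 ->
    `|f (q.1 + u *: q.2) - f (x + u *: e)| <= d.
Proof.
move=> oU cf xU d0.
apply: (@near_segment e (fun u y => `|f y - f (x + u *: e)| <= d)) => u u01.
have cfu := cf _ (xU u u01).
have c1 : (fun p : R * V => f p.2) @ (u, x + u *: e) --> f (x + u *: e).
  have c0 : (fun p : R * V => p.2) @ (u, x + u *: e) --> x + u *: e by exact: cvg_snd.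
  exact: (@cvg_comp _ _ _ (fun p : R * V => p.2) f _ _ _ c0 cfu).
have c2 : (fun p : R * V => f (x + p.1 *: e)) @ (u, x + u *: e) --> f (x + u *: e).
  have cl : (fun p : R * V => x + p.1 *: e) @ (u, x + u *: e) --> x + u *: e.
    exact: (cvgD (cvg_cst x) (cvgZ cvg_fst (cvg_cst e))).
  exact: (@cvg_comp _ _ _ (fun p : R * V => x + p.1 *: e) f _ _ _ cl cfu).
have c12 : (fun p : R * V => f p.2 - f (x + p.1 *: e)) @ (u, x + u *: e) -->
  f (x + u *: e) - f (x + u *: e) by exact: (cvgB c1 c2).
have /cvgrPdist_le/(_ d d0) := c12.
by apply: filterS => p; rewrite subrr sub0r normrN.
Qed.

(** Continuity is joint in the base point and in the vector of the segment, since
    estimates uniform on compact sets will be needed while the length of the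
    segments tends to 0. *)
Lemma lineavg_continuous w e f U x : continuous w -> open U ->
  (forall y, U y -> {for y, continuous f}) -> segment_in e U x ->
  lineavg w q.2 f q.1 @[q --> (x, e)] --> lineavg w e f x.
Proof.
move=> cw oU cf xU; apply/cvgrPdist_le => d d0.
have [M M0 wM] := @bound01 w (fun t _ => cw t).
have dM0 : 0 < d / M by rewrite divr_gt0.
have n1 := near_segment_in oU xU.
have n2 := near_uniform oU cf xU dM0.
near=> q.
have qU : segment_in q.2 U q.1 by near: q; exact: n1.
have qd : forall u : R, 0 <= u <= 1 ->
    `|f (q.1 + u *: q.2) - f (x + u *: e)| <= d / M by near: q; exact: n2.
rewrite distrC /lineavg -I01B; [|exact: cont01_seg qU|exact: cont01_seg xU].
apply: I01_bound; first by apply: cont01B; [exact: cont01_seg qU|exact: cont01_seg xU].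
move=> u u01; rewrite -mulrBr normrM.
rewrite -[leRHS](divfK (lt0r_neq0 M0)) mulrC ler_pM//; first exact: qd.
exact: wM.
Unshelve. all: by end_near. Qed.

Lemma lineavg_continuous_pt w e f U x : continuous w -> open U ->
  (forall y, U y -> {for y, continuous f}) -> segment_in e U x ->
  {for x, continuous (lineavg w e f)}.
Proof.
move=> cw oU cf xU.
have c : (fun y : V => (y, e)) @ x --> (x, e) by exact: (cvg_pair cvg_id (cvg_cst e)).
exact: (cvg_comp _ _ c (lineavg_continuous cw oU cf xU)).
Qed.

(** Derivation under the integral sign. By the mean value theorem the difference
    quotient of the integrand is a derivative of [f] at a nearby point, and
    [near_uniform] compares it with the derivative on the segment. *)
Lemma is_derive_lineavg w e f v U x : continuous w -> open U ->
  (forall y, U y -> {for y, continuous f}) ->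
  (forall y, U y -> derivable f y v) ->
  (forall y, U y -> {for y, continuous ('D_v f)}) -> segment_in e U x ->
  is_derive x v (lineavg w e f) (lineavg w e ('D_v f) x).
Proof.
move=> cw oU cf df cdf xU.
suff H : (fun h : R => h^-1 *: ((lineavg w e f \o shift x) (h *: v) - lineavg w e f x))
    @ 0^' --> lineavg w e ('D_v f) x.
  by split; [apply/cvg_ex; eexists; exact: H|exact: cvg_lim].
apply/cvgrPdist_le => d d0.
have [M M0 wM] := @bound01 w (fun t _ => cw t).
have dM0 : 0 < d / M by rewrite divr_gt0.
have : \forall q \near (x, e), segment_in q.2 U q.1 /\ forall u : R, 0 <= u <= 1 ->
    `|'D_v f (q.1 + u *: q.2) - 'D_v f (x + u *: e)| <= d / M.
  by apply: filterI; [exact: near_segment_in|exact: (near_uniform oU cdf xU dM0)].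
move=> /nbhs_ballP[r /= r0 Hr].
have Hs s : `|s *: v| < r -> segment_in e U (x + s *: v) /\
   forall u : R, 0 <= u <= 1 ->
     `|'D_v f (x + s *: v + u *: e) - 'D_v f (x + u *: e)| <= d / M.
  move=> sr; apply: (Hr (x + s *: v, e)); split => /=; last exact: ballxx.
  by rewrite -ball_normE /= opprD addrA subrr sub0r normrN.
near=> h.
have h0 : h != 0 by near: h; exact: nbhs_dnbhs_neq.
have hr : `|h *: v| < r.
  have h1 : `|h| < r / (`|v| + 1) by near: h; apply: dnbhs0_lt; rewrite divr_gt0// ltr_wpDl.
  rewrite normrZ (@le_lt_trans _ _ (`|h| * (`|v| + 1)))//.
    by rewrite ler_wpM2l// lerDl.
  by rewrite -ltr_pdivlMr// ltr_wpDl.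
have [hU _] := Hs h hr.
have ch := cont01_seg cw cf hU; have cx := cont01_seg cw cf xU.
have cdx := cont01_seg cw cdf xU.
have chx := @cont01Z _ h^-1 _ (cont01B ch cx).
rewrite distrC /= [h *: v + x]addrC /lineavg -I01B// -[_ *: _]/(_ * _).
rewrite -I01Z; last exact: cont01B.
rewrite -I01B//; apply: I01_bound; first exact: cont01B.
move=> u u01.
have [t th|s sh] := @MVT_line _ _ f (x + u *: e) v h.
  apply: df; rewrite addrAC; apply: (Hs t _).1 => //.
  by apply: le_lt_trans hr; rewrite !normrZ ler_wpM2r.
rewrite -mulrBr [x + h *: v + _]addrAC => ->.
rewrite mulrCA [h^-1 * _]mulKf// -mulrBr normrM.
rewrite -[leRHS](divfK (lt0r_neq0 M0)) mulrC ler_pM//; last exact: wM.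
rewrite [x + u *: e + _]addrAC; apply: (Hs s _).2 => //.
by apply: le_lt_trans hr; rewrite !normrZ ler_wpM2r.
Unshelve. all: by end_near. Qed.

End averages.

(** * Exchanging a derivative for a derivative of the weight *)

Section by_parts.
Context {R : realType}.

Lemma lineavg_by_parts (V : normedModType R) (w : R -> R) (e : V) (f : V -> R) (U : set V) (x : V) :
  (forall t : R, derivable w t 1) -> continuous (derive1 w) ->
  (forall y, U y -> {for y, continuous f}) ->
  (forall y, U y -> derivable f y e) ->
  (forall y, U y -> {for y, continuous ('D_e f)}) -> segment_in e U x ->
  lineavg w e ('D_e f) x = w 1 * f (x + e) - w 0 * f x - lineavg (derive1 w) e f x.
Proof.
move=> dw cdw cf df cdf xU.
have cw : continuous w.
  by move=> t; have /derivable1_diffP/differentiable_continuous := dw t.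
pose F u := w u * f (x + u *: e).
have dF (u : R) : 0 <= u <= 1 -> is_derive u 1 F
    (w u * 'D_e f (x + u *: e) + derive1 w u * f (x + u *: e)).
  move=> u01.
  have d1 : is_derive u 1 w (derive1 w u).
    by rewrite derive1E; exact: derivableP.
  have d2 := is_derive_line (df _ (xU u u01)).
  have dM := is_deriveM d1 d2.
  apply: (is_derive_eq dM).
  by rewrite ![_ *: _]/(_ * _); congr (_ + _); rewrite mulrC.
have c1 := cont01_seg cw cdf xU; have c2 := cont01_seg cdw cf xU.
have cD : cont01 (fun u => w u * 'D_e f (x + u *: e) + derive1 w u * f (x + u *: e)).
  by move=> t t01; exact: (cvgD (c1 t t01) (c2 t t01)).
have := I01_FTC dF cD; rewrite I01D// /F scale1r scale0r addr0 => <-.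
by rewrite addrK.
Qed.

Lemma eq_lineavg (V V' : normedModType R) (w : R -> R) (e : V) (e' : V') (f : V -> R)
    (g : V' -> R) x y :
  (forall u : R, 0 <= u <= 1 -> f (x + u *: e) = g (y + u *: e')) ->
  lineavg w e f x = lineavg w e' g y.
Proof. by move=> fg; apply: eq_I01 => u /fg ->. Qed.

(** The average is derivable in the direction of the segment although [f] is
    only continuous: this is the gain of regularity. Restrict [f] to the line
    spanned by [e] and integrate it to [Phi]; the average of [f] is the average
    of the derivative of [Phi], that is, by parts, minus the average of [Phi]
    with weight w', and that one is derivable because [Phi] is C^1. *)
Lemma is_derive_lineavg_flat (V : normedModType R) (w : R -> R) (e : V) (f : V -> R) (U : set V) (x : V) :
  (forall t : R, derivable w t 1) -> continuous (derive1 w) ->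
  w 0 = 0 -> w 1 = 0 -> open U ->
  (forall y, U y -> {for y, continuous f}) -> segment_in e U x ->
  is_derive x e (lineavg w e f) (- lineavg (derive1 w) e f x).
Proof.
move=> dw cdw w0 w1 oU cf xU.
have cw : continuous w.
  by move=> t; have /derivable1_diffP/differentiable_continuous := dw t.
have [d d0 dU] : exists2 d : R, 0 < d & forall h : R, `|h| < d ->
    segment_in e U (x + h *: e).
  have /nbhs_ballP[r /= r0 Hr] := near_segment_in oU xU.
  exists (r / (`|e| + 1)); first by rewrite divr_gt0// ltr_wpDl.
  move=> h hr; apply: (Hr (x + h *: e, e)); split => /=; last exact: ballxx.
  rewrite -ball_normE /= opprD addrA subrr sub0r normrN normrZ.
  rewrite (@le_lt_trans _ _ (`|h| * (`|e| + 1)))//.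
    by rewrite ler_wpM2l// lerDl.
  by rewrite -ltr_pdivlMr// ltr_wpDl.
pose phi (t : R) := f (x + t *: e).
have cphi (t : R) : - d < t < 1 + d -> {for t, continuous phi}.
  move=> /andP[td t1d].
  have cl : {for t, continuous (fun u : R => x + u *: e)}.
    exact: (cvgD (cvg_cst x) (cvgZ cvg_id (cvg_cst e))).
  apply: (continuous_comp cl (cf _ _)).
  have [t0|t0] := ltP t 0.
    have td' : `|t| < d by rewrite ltr0_norm// ltrNl.
    by have := dU t td' 0; rewrite lexx ler01 scale0r addr0; exact.
  have [t1|t1] := leP t 1.
    have d0' : `|0 : R| < d by rewrite normr0.
    by have := dU 0 d0' t; rewrite t0 t1 scale0r addr0; exact.
  have td' : `|t - 1| < d by rewrite gtr0_norm ?subr_gt0// ltrBlDl.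
  by have := dU _ td' 1; rewrite lexx ler01 -addrA -scalerDl subrK; exact.
(* The margins d/2 keep the segments issued from the points close to [x]
   inside the open interval where [Phi] is C^1. *)
pose a : R := - (d / 2); pose b : R := 1 + d / 2.
pose Phi (t : R) : R := \int[lebesgue_measure]_(u in `[a, t]) phi u.
have dPhi (t : R) : a < t < b -> is_derive t 1 Phi (phi t).
  move=> /andP[at_ tb].
  have iphi : lebesgue_measure.-integrable `[a, b] (EFin \o phi).
    apply: continuous_compact_integrable; first exact: segment_compact.
    apply: continuous_in_subspaceT => u; rewrite inE/= in_itv/= => /andP[au ub].
    by apply: cphi; rewrite /a /b in au ub; apply/andP; split; lra.
  have ct : {for t, continuous phi}.
    by apply: cphi; rewrite /a /b in at_ tb; apply/andP; split; lra.
  have [D E] := continuous_FTC1_closed tb iphi at_ ct.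
  by split => //; rewrite -derive1E.
pose I : set R := [set t | a < t < b].
have oI : open I.
  rewrite (_ : I = `]a, b[%classic); first exact: interval_open.
  by apply/seteqP; split => t; rewrite /I /= in_itv.
have ddPhi t : I t -> derivable Phi t 1 by move=> /dPhi[].
have EPhi t : I t -> 'D_1 Phi t = phi t by move=> /dPhi[].
have cPhi t : I t -> {for t, continuous Phi}.
  by move=> /dPhi[/derivable1_diffP/differentiable_continuous].
have cDPhi t : I t -> {for t, continuous ('D_1 Phi)}.
  move=> It; have n : \near t, phi t = 'D_1 Phi t.
    by apply: filterS (open_nbhs_nbhs (conj oI It)) => s /EPhi ->.
  have cphit : {for t, continuous phi}.
    apply: cphi; move: It => /andP[]; rewrite /a /b => ta tb.
    by apply/andP; split; lra.
  rewrite /prop_for /continuous_at -(nbhs_singleton n).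
  exact: cvg_trans (near_eq_cvg n) cphit.
have Iseg (h : R) : `|h| < d / 2 -> segment_in (1 : R) I h.
  rewrite ltr_norml => /andP[h1 h2] u /andP[u0 u1].
  by rewrite /I /= [u *: 1]mulr1 /a /b; apply/andP; split; lra.
have d20 : 0 < d / 2 by rewrite divr_gt0.
apply: line_is_derive.
have nd : \forall h \near (0 : R), `|h| < d / 2 by exact: (@nbhs0_lt _ R _ d20).
have n : \forall h \near (0 : R), (-1 \*: lineavg (derive1 w) (1 : R) Phi) h = lineavg w e f (x + h *: e).
  near=> h.
  have hd : `|h| < d / 2 by near: h; exact: nd.
  have := lineavg_by_parts dw cdw cPhi ddPhi cDPhi (Iseg h hd).
  rewrite w0 w1 !mul0r subrr sub0r => E.
  rewrite -[LHS]/(-1 * lineavg (derive1 w) (1 : R) Phi h) mulN1r -E.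
  apply: eq_lineavg => u u01; rewrite EPhi; last exact: Iseg.
  by rewrite /phi scalerDl addrA [u *: 1]mulr1.
apply: (near_eq_is_derive n).
have I0 : segment_in (1 : R) I 0 by apply: Iseg; rewrite normr0.
have dJ := is_derive_lineavg cdw oI cPhi ddPhi cDPhi I0.
have := is_deriveZ (-1) dJ; rewrite [_ *: _]mulN1r.
rewrite (_ : lineavg (derive1 w) (1 : R) ('D_1 Phi) 0 = lineavg (derive1 w) e f x)//.
apply: eq_lineavg => u u01; rewrite EPhi; last exact: I0.
by rewrite /phi add0r [u *: 1]mulr1.
Unshelve. all: by end_near. Qed.

End by_parts.

(** * Regularity of averages *)

Section pointwise_derive.
Context {R : realType} {V : normedModType R}.
Implicit Types (f g : V -> R) (x v : V) (df dg : R).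

Lemma derive_fD f g x v df dg : is_derive x v f df -> is_derive x v g dg ->
  is_derive x v (fun y => f y + g y) (df + dg).
Proof. by move=> Hf Hg; exact: (is_deriveD Hf Hg). Qed.

Lemma derive_fB f g x v df dg : is_derive x v f df -> is_derive x v g dg ->
  is_derive x v (fun y => f y - g y) (df - dg).
Proof. by move=> Hf Hg; exact: (is_deriveB Hf Hg). Qed.

Lemma derive_fM f g x v df dg : is_derive x v f df -> is_derive x v g dg ->
  is_derive x v (fun y => f y * g y) (f x * dg + df * g x).
Proof.
move=> Hf Hg; apply: (is_derive_eq (is_deriveM Hf Hg)).
by rewrite ![_ *: _]/(_ * _) [df * _]mulrC.
Qed.

Lemma derive_fZ (c : R) f x v df : is_derive x v f df ->
  is_derive x v (fun y => c * f y) (c * df).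
Proof. by move=> Hf; exact: (is_deriveZ c Hf). Qed.

Lemma derive_fsum (I : Type) (r : seq I) (F : I -> V -> R) x v (dF : I -> R) :
  (forall i, is_derive x v (F i) (dF i)) ->
  is_derive x v (fun y => \sum_(i <- r) F i y) (\sum_(i <- r) dF i).
Proof.
move=> HF; elim: r => [|i r IH].
  rewrite big_nil (_ : (fun _ => _) = cst 0); first exact: is_derive_cst.
  by apply/funext => y; rewrite big_nil.
rewrite big_cons (_ : (fun _ => _) = fun y => F i y + \sum_(j <- r) F j y).
  exact: derive_fD.
by apply/funext => y; rewrite big_cons.
Qed.

Lemma Cp_is_derive n (S : {pred 'I_n}) k U (f : 'rV[R]_n -> R) b (x : 'rV[R]_n) :
  Cp S k.+1 U f -> b \in S -> U x -> is_derive x (basis_vec R b) f (pd b f x).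
Proof. by move=> Cf bS Ux; apply: derivableP; exact: Cp_derivable Cf bS Ux. Qed.

End pointwise_derive.

Section regularity_of_averages.
Context {R : realType} {n : nat}.
Implicit Types (w : R -> R) (f : 'rV[R]_n -> R) (U V : set 'rV[R]_n)
  (S : {pred 'I_n}).

Lemma smooth_line_continuous w : smooth_line w -> continuous w.
Proof. by move=> /(_ 0%N)[]. Qed.

Lemma smooth_line_derivable w : smooth_line w -> forall t : R, derivable w t 1.
Proof. by move=> /(_ 1%N)[_ []]. Qed.

Lemma smooth_line_derive w : smooth_line w -> smooth_line (derive1 w).
Proof. by move=> sw k; have [_ []] := sw k.+1. Qed.

(** Weights that extend by 0 to smooth functions on the line. This class is
    stable under derivation and its members vanish at both ends, so that the
    boundary terms of integrations by parts disappear at every order. *)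
Definition flat01 w := [/\ smooth_line w, \forall t \near (0 : R), w t = 0
  & \forall t \near (1 : R), w t = 0].

Lemma flat01_derive w : flat01 w -> flat01 (derive1 w).
Proof.
have H (t0 : R) : (\forall t \near t0, w t = 0) -> \forall t \near t0, derive1 w t = 0.
  move=> /nbhs_interior; apply: filterS => t wt.
  rewrite derive1E -[RHS](derive_cst (0 : R) t 1).
  exact: near_eq_derive wt.
by move=> [sw w0 w1]; split; [exact: smooth_line_derive|exact: H|exact: H].
Qed.

Lemma Cp_lineavg w (e : 'rV[R]_n) S k U V f : smooth_line w -> open U ->
  open V -> (forall x, V x -> segment_in e U x) ->
  Cp S k U f -> Cp S k V (lineavg w e f).
Proof.
move=> sw oU oV VU; have cw := smooth_line_continuous sw.
elim: k f => [|k IH] f Cf.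
  split => // x /VU xU.
  by apply: (lineavg_continuous_pt cw oU _ xU) => y; exact: Cp_continuous Cf.
split.
  move=> x /VU xU.
  by apply: (lineavg_continuous_pt cw oU _ xU) => y; exact: Cp_continuous Cf.
move=> b bS; have dJ x : V x ->
    is_derive x (basis_vec R b) (lineavg w e f) (lineavg w e (pd b f) x).
  move=> /VU xU; apply: (is_derive_lineavg cw oU _ _ _ xU) => y Uy.
  - exact: Cp_continuous Cf Uy.
  - exact: Cp_derivable Cf bS Uy.
  - exact: Cp_continuous (Cp_pd Cf bS) Uy.
split; first by move=> x /dJ[].
apply: (@Cp_eq _ _ _ _ _ (lineavg w e (pd b f))) => //.
  by move=> x; rewrite inE => /dJ[_ ->].
exact/IH/(Cp_pd Cf).
Qed.

(** A partial derivative in the direction of the segment falls on the weight and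
    leaves [f] as it is; in the other directions it falls on [f], which has it
    by assumption. *)
Lemma Cp_lineavg_gain w (a : 'I_n) (eps : R) S k U V f : flat01 w -> eps != 0 ->
  open U -> open V -> (forall x, V x -> segment_in (eps *: basis_vec R a) U x) ->
  Cp S k U f -> Cp [predU1 a & S] k V (lineavg w (eps *: basis_vec R a) f).
Proof.
move=> + eps0 oU oV VU; set e := eps *: _.
elim: k w f => [|k IH] w f fw Cf; have [sw w0 w1] := fw;
  have cw := smooth_line_continuous sw.
  split => // x /VU xU.
  by apply: (lineavg_continuous_pt cw oU _ xU) => y; exact: Cp_continuous Cf.
split.
  move=> x /VU xU.
  by apply: (lineavg_continuous_pt cw oU _ xU) => y; exact: Cp_continuous Cf.
move=> b; rewrite inE => /orP[/eqP ->|bS].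
- have dJ x : V x -> is_derive x (basis_vec R a) (lineavg w e f)
      (- eps^-1 * lineavg (derive1 w) e f x).
    move=> /VU xU.
    have -> : basis_vec R a = eps^-1 *: e by rewrite /e scalerA mulVf// scale1r.
    rewrite mulNr -mulrN; apply: is_derive_scale.
    apply: (is_derive_lineavg_flat _ _ _ _ oU _ xU).
    + exact: smooth_line_derivable.
    + exact/smooth_line_continuous/smooth_line_derive.
    + exact: nbhs_singleton w0.
    + exact: nbhs_singleton w1.
    + by move=> y; exact: Cp_continuous Cf.
  split; first by move=> x /dJ[].
  apply: (@Cp_eq _ _ _ _ _ (fun x => - eps^-1 * lineavg (derive1 w) e f x)) => //.
    by move=> x; rewrite inE => /dJ[_ ->].
  apply: CpM => //; first exact: Cp_cst.
  by apply: IH; [exact: flat01_derive|exact: CpS].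
- have dJ x : V x ->
      is_derive x (basis_vec R b) (lineavg w e f) (lineavg w e (pd b f) x).
    move=> /VU xU; apply: (is_derive_lineavg cw oU _ _ _ xU) => y Uy.
    + exact: Cp_continuous Cf Uy.
    + exact: Cp_derivable Cf bS Uy.
    + exact: Cp_continuous (Cp_pd Cf bS) Uy.
  split; first by move=> x /dJ[].
  apply: (@Cp_eq _ _ _ _ _ (lineavg w e (pd b f))) => //.
    by move=> x; rewrite inE => /dJ[_ ->].
  by apply: IH => //; exact: Cp_pd Cf bS.
Qed.

Lemma lineavg_sum w (e : 'rV[R]_n) U m (f : 'I_m -> 'rV[R]_n -> R) x :
  continuous w -> open U -> (forall i y, U y -> {for y, continuous (f i)}) ->
  segment_in e U x ->
  \sum_(i < m) lineavg w e (f i) x = lineavg w e (fun y => \sum_(i < m) f i y) x.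
Proof.
move=> cw oU cf xU.
have cS (r : seq 'I_m) y : U y -> {for y, continuous (fun y => \sum_(i <- r) f i y)}.
  move=> Uy; have : Cp predT 0 U (fun y => \sum_(i <- r) f i y).
    by apply: Cp_sum => // i _; split => //; exact: cf.
  by move=> /Cp_continuous; exact.
elim: (index_enum _) => [|i r IH].
  rewrite big_nil /lineavg (@eq_I01 _ _ (fun=> 0)) ?I01_cst//.
  by move=> u _; rewrite big_nil mulr0.
rewrite big_cons IH /lineavg -I01D.
- by apply: eq_I01 => u _; rewrite big_cons mulrDr.
- exact: cont01_seg (cf i) xU.
- exact: cont01_seg (cS r) xU.
Qed.

Lemma lineavg0 w f x : cont01 w -> lineavg w 0 f x = I01 w * f x.
Proof.
move=> cw; rewrite mulrC -I01Z//; apply: eq_I01 => u _.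
by rewrite scaler0 addr0 mulrC.
Qed.

(** The limit as the segment shrinks to a point that is itself moving: this
    double limit is what turns into uniform estimates on compact sets. *)
Lemma lineavg_limit w (a : 'I_n) U f x : continuous w -> open U -> U x ->
  (forall y, U y -> {for y, continuous f}) ->
  lineavg w (q.2 *: basis_vec R a) f q.1 @[q --> (x, 0 : R)] --> I01 w * f x.
Proof.
move=> cw oU Ux cf; rewrite -lineavg0; last by move=> t _; exact: cw.
have xU : segment_in 0 U x by move=> u _; rewrite scaler0 addr0.
have c : (fun q : 'rV[R]_n * R => (q.1, q.2 *: basis_vec R a)) @ (x, 0 : R) --> (x, 0 : 'rV[R]_n).
  have c2 : (fun q : 'rV[R]_n * R => q.2 *: basis_vec R a) @ (x, 0 : R) --> 0 *: basis_vec R a.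
    exact: (cvgZ cvg_snd (cvg_cst _)).
  rewrite scale0r in c2.
  exact: (cvg_pair cvg_fst c2).
exact: (cvg_comp _ _ c (lineavg_continuous cw oU cf xU)).
Qed.

End regularity_of_averages.

Section kernel.
Context {R : realType}.

(** Equal to 1 on [0, 1/3] and to 0 on [2/3, 1]. Thus minus its derivative is a
    mollifier of integral 1 in [flat01], and [kappa] is the primitive of that
    mollifier which vanishes at 1. *)
Definition kappa (t : R) : R := 1 - smooth_step (3 * t + -1).

Lemma smooth_kappa : smooth_line kappa.
Proof.
move=> k; rewrite (_ : kappa = fun t => 1 + -1 * smooth_step (3 * t + -1)).
  apply: ClineD; first exact: Cline_cst.
  apply: ClineM; first exact: Cline_cst.
  exact/(@Cline_affine _ _ smooth_step)/smooth_smooth_step.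
by apply/funext => t; rewrite mulN1r.
Qed.

Lemma kappa0 : kappa 0 = 1.
Proof. by rewrite /kappa smooth_step0 ?subr0// mulr0 add0r lerN10. Qed.

Lemma kappa1 : kappa 1 = 0.
Proof. by rewrite /kappa smooth_step1 ?subrr//; lra. Qed.

Lemma flat01_kappa' : flat01 (derive1 kappa).
Proof.
have H (c t0 : R) : (\forall t \near t0, kappa t = c) ->
    \forall t \near t0, derive1 kappa t = 0.
  move=> /nbhs_interior; apply: filterS => t wt.
  rewrite derive1E -[RHS](derive_cst c t 1).
  exact: near_eq_derive wt.
split; first exact/smooth_line_derive/smooth_kappa.
- apply: (H 1); near=> t; rewrite /kappa smooth_step0 ?subr0//.
  have : t < 3^-1 by near: t; apply: lt_nbhsl; rewrite invr_gt0.
  by move=> ?; lra.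
- apply: (H 0); near=> t; rewrite /kappa smooth_step1 ?subrr//.
  have : 2 / 3 < t by near: t; apply: lt_nbhsr; lra.
  by move=> ?; lra.
Unshelve. all: by end_near. Qed.

Lemma I01_kappa' : I01 (derive1 kappa) = -1.
Proof.
have d (t : R) : 0 <= t <= 1 -> is_derive t 1 kappa (derive1 kappa t).
  by move=> _; rewrite derive1E; apply: derivableP; exact/smooth_line_derivable/smooth_kappa.
rewrite (I01_FTC d) ?kappa0 ?kappa1 ?sub0r// => t _.
exact/smooth_line_continuous/smooth_line_derive/smooth_kappa.
Qed.

End kernel.

(** * Divergence-free mollification in one direction *)

Section vanishing_limits.
Context {R : realType} {T : Type} {F : set_system T} {FF : Filter F}.
Implicit Types (f g : T -> R).

Lemma cvgM0 f g (l : R) : f q @[q --> F] --> l -> g q @[q --> F] --> (0 : R) ->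
  f q * g q @[q --> F] --> (0 : R).
Proof. by move=> Hf Hg; have := cvgM Hf Hg; rewrite mulr0; exact. Qed.

Lemma cvgD0 f g : f q @[q --> F] --> (0 : R) -> g q @[q --> F] --> (0 : R) ->
  f q + g q @[q --> F] --> (0 : R).
Proof. by move=> Hf Hg; have := cvgD Hf Hg; rewrite addr0; exact. Qed.

Lemma cvgB0 f g : f q @[q --> F] --> (0 : R) -> g q @[q --> F] --> (0 : R) ->
  f q - g q @[q --> F] --> (0 : R).
Proof. by move=> Hf Hg; have := cvgB Hf Hg; rewrite subr0; exact. Qed.

Lemma cvg_bigsum m (g : 'I_m -> T -> R) (l : 'I_m -> R) :
  (forall i, g i q @[q --> F] --> l i) ->
  (\sum_(i < m) g i q) @[q --> F] --> \sum_(i < m) l i.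
Proof.
move=> Hg; elim: (index_enum _) => [|i r IH].
  rewrite big_nil (_ : (fun _ => _) = fun=> 0); first exact: cvg_cst.
  by apply/funext => q; rewrite big_nil.
rewrite big_cons (_ : (fun _ => _) = fun q => g i q + \sum_(i <- r) g i q).
  exact: (cvgD (Hg i) IH).
by apply/funext => q; rewrite big_cons.
Qed.

Lemma cvg_sum0 m (g : 'I_m -> T -> R) :
  (forall i, g i q @[q --> F] --> (0 : R)) ->
  (\sum_(i < m) g i q) @[q --> F] --> (0 : R).
Proof. by move=> /cvg_bigsum; rewrite big1; exact. Qed.

End vanishing_limits.

(** The construction at the heart of the proof. Let [Y] be a C^1 field on [Omega]
    with zero Euclidean divergence, [a] a direction and [chi] a smooth cutoff.
    Write A = A_eps for the average eps * lineavg kappa (eps e_a) and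
    T = T_eps for the mollifier lineavg (- kappa') (eps e_a). By parts,

      d_a (A Y) = T Y - Y,

    so that the change T Y - Y made by mollification is itself a derivative in
    the direction [a]. Cutting off the potential V = A Y by [chi], the field

      W = d_a (chi V) - div (chi V) e_a

    has divergence d_a div (chi V) - d_a div (chi V) = 0 and its support in that
    of [chi]. Where chi = 1 it is T Y - Y, because div V = A (div Y) = 0; hence
    Y + W = T Y there, which has gained derivatives in the direction [a].
    Everywhere W is as regular as Y, and W tends to 0 in C^1 with eps since A
    and T - 1 tend to 0. *)
Section perturbation.
Context {R : realType} {n : nat}.
Variables (Omega : set 'rV[R]_n) (a : 'I_n) (Y : 'I_n -> 'rV[R]_n -> R)
  (chi : 'rV[R]_n -> R).

Let ev (eps : R) : 'rV[R]_n := eps *: basis_vec R a.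

Definition potential (eps : R) (c : 'I_n) (x : 'rV[R]_n) : R :=
  eps * lineavg kappa (ev eps) (Y c) x.

Definition mollified (eps : R) (c : 'I_n) (x : 'rV[R]_n) : R :=
  -1 * lineavg (derive1 kappa) (ev eps) (Y c) x.

(** The field W, expanded with d_a V = T Y - Y and div V = 0. In this form there
    is no derivative of [Y] left, and so no loss of regularity. *)
Definition correction (eps : R) (c : 'I_n) (x : 'rV[R]_n) : R :=
  pd a chi x * potential eps c x + chi x * (mollified eps c x - Y c x)
  - (c == a)%:R * \sum_(b < n) pd b chi x * potential eps b x.

Definition dpotential (eps : R) (d c : 'I_n) (x : 'rV[R]_n) : R :=
  eps * lineavg kappa (ev eps) (pd d (Y c)) x.

Definition dmollified (eps : R) (d c : 'I_n) (x : 'rV[R]_n) : R :=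
  -1 * lineavg (derive1 kappa) (ev eps) (pd d (Y c)) x.

Definition dcorrection (eps : R) (d c : 'I_n) (x : 'rV[R]_n) : R :=
  pd a chi x * dpotential eps d c x + pd d (pd a chi) x * potential eps c x
  + (chi x * (dmollified eps d c x - pd d (Y c) x)
     + pd d chi x * (mollified eps c x - Y c x))
  - (c == a)%:R * \sum_(b < n) (pd b chi x * dpotential eps d b x
                                + pd d (pd b chi) x * potential eps b x).

Hypotheses (oO : open Omega) (CY : forall c, Cp predT 1 Omega (Y c))
  (Cchi : forall k, Cp predT k setT chi).

Let skappa : smooth_line (@kappa R) := smooth_kappa.
Let skappa' : smooth_line (derive1 (@kappa R)) := smooth_line_derive skappa.
Let ckappa : continuous (@kappa R) := smooth_line_continuous skappa.
Let ckappa' : continuous (derive1 (@kappa R)) := smooth_line_continuous skappa'.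

Let cY c y : Omega y -> {for y, continuous (Y c)}.
Proof. exact: Cp_continuous (CY c). Qed.
Let dY c d y : Omega y -> derivable (Y c) y (basis_vec R d).
Proof. exact: Cp_derivable (CY c) (erefl : d \in predT). Qed.
Let cdY c d y : Omega y -> {for y, continuous (pd d (Y c))}.
Proof. exact: Cp_continuous (Cp_pd (CY c) (erefl : d \in predT)). Qed.

Let dchi b x : is_derive x (basis_vec R b) chi (pd b chi x).
Proof. exact: Cp_is_derive (Cchi 1) (erefl : b \in predT) _. Qed.
Let ddchi b d x : is_derive x (basis_vec R d) (pd b chi) (pd d (pd b chi) x).
Proof.
exact: Cp_is_derive (Cp_pd (Cchi 2) (erefl : b \in predT)) (erefl : d \in predT) _.
Qed.

Lemma is_derive_lineavg_Y (w : R -> R) eps c d x : continuous w -> segment_in (ev eps) Omega x ->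
  is_derive x (basis_vec R d) (lineavg w (ev eps) (Y c)) (lineavg w (ev eps) (pd d (Y c)) x).
Proof.
move=> cw xO; apply: (is_derive_lineavg cw oO _ _ _ xO) => y.
- exact: cY.
- exact: dY.
- exact: cdY.
Qed.

Lemma is_derive_correction eps c d x : segment_in (ev eps) Omega x ->
  is_derive x (basis_vec R d) (correction eps c) (dcorrection eps d c x).
Proof.
move=> xO.
have xOm : Omega x by have := xO 0; rewrite scale0r addr0 lexx ler01; exact.
have dA b : is_derive x (basis_vec R d) (potential eps b) (dpotential eps d b x).
  by apply: derive_fZ; exact: is_derive_lineavg_Y.
have dT : is_derive x (basis_vec R d) (mollified eps c) (dmollified eps d c x).
  by apply: derive_fZ; exact: is_derive_lineavg_Y.
apply: derive_fB.
  apply: derive_fD; first exact: derive_fM.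
  apply: derive_fM => //; apply: derive_fB => //.
  by apply: derivableP; exact: dY.
by apply: derive_fZ; exact: (derive_fsum (index_enum _) (fun b => derive_fM (ddchi b d x) (dA b))).
Qed.

(** This is d_a (A Y) = T Y - Y; the boundary terms come from kappa(0) = 1 and
    kappa(1) = 0. *)
Lemma mollified_sub eps c x : segment_in (ev eps) Omega x ->
  dpotential eps a c x = mollified eps c x - Y c x.
Proof.
move=> xO.
have EY y : Omega y -> 'D_(ev eps) (Y c) y = eps * pd a (Y c) y.
  by move=> Oy; have [] := is_derive_scale eps (derivableP (@dY c a y Oy)).
have dYe y : Omega y -> derivable (Y c) y (ev eps).
  by move=> Oy; have [] := is_derive_scale eps (derivableP (@dY c a y Oy)).
have Ceps : Cp predT 0 Omega (fun y => eps * pd a (Y c) y).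
  exact: (CpM oO (@Cp_cst _ _ predT 0 Omega eps) (Cp_pd (CY c) (erefl : a \in predT))).
have cYe y : Omega y -> {for y, continuous ('D_(ev eps) (Y c))}.
  move=> Oy; apply: (@Cp_continuous _ _ predT 0 Omega) Oy.
  by apply: Cp_eq Ceps => // z; rewrite inE => /EY.
have := lineavg_by_parts (smooth_line_derivable skappa) ckappa' (@cY c) dYe cYe xO.
rewrite kappa0 kappa1 mul0r mul1r sub0r => E.
rewrite /dpotential /mollified mulN1r addrC -E -I01Z; last first.
  exact: cont01_seg ckappa (@cdY c a) xO.
by apply: eq_I01 => u u01; rewrite mulrCA EY//; exact: xO.
Qed.

Lemma lineavg_divergence w eps x : (forall y, Omega y -> \sum_(c < n) pd c (Y c) y = 0) ->
  continuous w -> segment_in (ev eps) Omega x ->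
  \sum_(c < n) lineavg w (ev eps) (pd c (Y c)) x = 0.
Proof.
move=> divY cw xO; rewrite (lineavg_sum cw oO _ xO); last by move=> c y; exact: cdY.
rewrite /lineavg (@eq_I01 _ _ (fun=> 0)) ?I01_cst// => u u01.
by rewrite divY ?mulr0//; exact: xO.
Qed.

Lemma sum_delta (s : 'I_n -> R) : \sum_(c < n) (c == a)%:R * s c = s a.
Proof.
rewrite (bigD1 a)//= eqxx mul1r big1 ?addr0// => c /negPf ca.
by rewrite ca mul0r.
Qed.

(** The cancellation behind div W = 0 as a statement about numbers: [dA], [dT],
    [dy] stand for the derivatives of A Y, T Y and Y, [q] and [dd] for the first
    and second derivatives of [chi]. The hypotheses are that A Y, T Y and Y have
    zero divergence, that d_a (A Y) = T Y - Y, and that the second derivatives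
    of [chi] are symmetric. *)
Lemma cancel_divergence (k l : R) (dA dd : 'I_n -> 'I_n -> R)
    (A dT dy D q : 'I_n -> R) :
  \sum_(c < n) dA c c = 0 -> \sum_(c < n) dT c = 0 -> \sum_(c < n) dy c = 0 ->
  (forall b, dA a b = D b) -> (forall b, dd a b = dd b a) ->
  \sum_(c < n) (k * dA c c + dd c a * A c + (l * (dT c - dy c) + q c * D c)
    - (c == a)%:R * \sum_(b < n) (q b * dA c b + dd c b * A b)) = 0.
Proof.
move=> zA zT zy dAD ddC; rewrite sumrB !big_split/= -!mulr_sumr sumrB zA zT zy.
rewrite subr0 !mulr0 !add0r sum_delta big_split/=.
under [in X in _ - X]eq_bigr do rewrite dAD.
under [X in _ - (_ + X)]eq_bigr do rewrite ddC.
by rewrite [X in _ - X]addrC subrr.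
Qed.

Lemma correction_divergence eps x :
  (forall y, Omega y -> \sum_(c < n) pd c (Y c) y = 0) ->
  segment_in (ev eps) Omega x ->
  \sum_(c < n) pd c (correction eps c) x = 0.
Proof.
move=> divY xO.
have xOm : Omega x by have := xO 0; rewrite scale0r addr0 lexx ler01; exact.
under eq_bigr => c _ do rewrite (@derive_val _ _ _ _ _ _ _ (is_derive_correction c c xO)).
apply: (@cancel_divergence _ _ (fun d b => dpotential eps d b x)
  (fun d b => pd d (pd b chi) x) (fun b => potential eps b x)
  (fun c => dmollified eps c c x) (fun c => pd c (Y c) x)
  (fun b => mollified eps b x - Y b x) (fun b => pd b chi x)).
- by rewrite -mulr_sumr lineavg_divergence// mulr0.
- by rewrite -mulr_sumr lineavg_divergence// mulr0.
- exact: divY.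
- by move=> b; exact: mollified_sub.
- by move=> b; apply: (@pd_commute _ _ setT 0 chi a b x) => //; exact: openT.
Qed.

Lemma correction_Cp U V S k eps c : open U -> open V -> (forall b, Cp S k U (Y b)) ->
  (forall x, V x -> segment_in (ev eps) U x) -> Cp S k V (correction eps c).
Proof.
move=> oU oV CUY VU.
have CJ w b : smooth_line w -> Cp S k V (lineavg w (ev eps) (Y b)).
  by move=> sw; apply: (Cp_lineavg sw oU oV VU).
have Cch : Cp S k V chi by apply: Cp_subset (Cchi k).
have Cdch b : Cp S k V (pd b chi).
  by apply: Cp_subset (Cp_pd (Cchi k.+1) (erefl : b \in predT)).
have CA b : Cp S k V (potential eps b).
  by apply: CpM => //; [exact: Cp_cst|exact: CJ].
apply: CpB => //.
  apply: CpD => //; first exact: CpM.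
  apply: CpM => //; apply: CpB => //.
    by apply: CpM => //; [exact: Cp_cst|exact: CJ].
  apply: Cp_subopen (CUY c) => x /VU /(_ 0).
  by rewrite scale0r addr0 lexx ler01; exact.
apply: CpM => //; first exact: Cp_cst.
by apply: Cp_sum => // b _; exact: CpM.
Qed.

(** Where chi = 1 the corrected field is T Y, an average with a weight in
    [flat01]. *)
Lemma corrected_gain U V S k eps c : open U -> open V -> eps != 0 ->
  Cp S k U (Y c) -> (forall x, V x -> segment_in (ev eps) U x) ->
  (forall x, V x -> chi x = 1) ->
  Cp [predU1 a & S] k V (fun x => Y c x + correction eps c x).
Proof.
move=> oU oV eps0 CUY VU chi1.
have dchi0 b x : V x -> pd b chi x = 0.
  move=> Vx; rewrite -[RHS](derive_cst (1 : R) x (basis_vec R b)).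
  apply: near_eq_derive; apply: filterS (near_of_open oV Vx) => y.
  exact: chi1.
apply: (@Cp_eq _ _ _ _ _ (mollified eps c)) => //.
  move=> x; rewrite inE => Vx; rewrite /correction chi1// dchi0// mul0r add0r mul1r.
  rewrite big1 ?mulr0 ?subr0; first by rewrite addrC subrK.
  by move=> b _; rewrite dchi0// mul0r.
apply: CpM => //; first exact: Cp_cst.
by apply: (Cp_lineavg_gain flat01_kappa' eps0 oU oV).
Qed.

Lemma correction_local eps c x : (\near x, chi x = 0) -> correction eps c x = 0.
Proof.
move=> chi0.
have dchi0 b : pd b chi x = 0.
  rewrite -[RHS](derive_cst (0 : R) x (basis_vec R b)).
  exact: near_eq_derive.
rewrite /correction (nbhs_singleton chi0) dchi0 !mul0r add0r.
by rewrite big1 ?mulr0 ?subr0// => b _; rewrite dchi0 mul0r.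
Qed.

Let cvg_pt (f : 'rV[R]_n -> R) (x : 'rV[R]_n) : {for x, continuous f} ->
  f q.1 @[q --> (x, 0 : R)] --> f x.
Proof.
move=> cf.
have c0 : (fun q : 'rV[R]_n * R => q.1) @ (x, 0 : R) --> x by exact: cvg_fst.
exact: (@cvg_comp _ _ _ (fun q : 'rV[R]_n * R => q.1) f _ _ _ c0 cf).
Qed.

Let lchi x : chi q.1 @[q --> (x, 0 : R)] --> chi x.
Proof. by apply: cvg_pt; exact: Cp_continuous (Cchi 0) _. Qed.
Let ldchi b x : pd b chi q.1 @[q --> (x, 0 : R)] --> pd b chi x.
Proof.
by apply: cvg_pt; exact: Cp_continuous (Cp_pd (Cchi 1) (erefl : b \in predT)) _.
Qed.
Let lddchi b d x : pd d (pd b chi) q.1 @[q --> (x, 0 : R)] --> pd d (pd b chi) x.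
Proof.
by apply: cvg_pt; exact: Cp_continuous
  (Cp_pd (Cp_pd (Cchi 2) (erefl : b \in predT)) (erefl : d \in predT)) _.
Qed.

Let lA (f : 'rV[R]_n -> R) x : Omega x -> (forall y, Omega y -> {for y, continuous f}) ->
  q.2 * lineavg kappa (ev q.2) f q.1 @[q --> (x, 0 : R)] --> (0 : R).
Proof.
move=> Ox cf.
have c0 : (fun q : 'rV[R]_n * R => q.2) @ (x, 0 : R) --> (0 : R) by exact: cvg_snd.
by have := cvgM c0 (lineavg_limit a ckappa oO Ox cf); rewrite mul0r; exact.
Qed.

Let lT (f : 'rV[R]_n -> R) x : Omega x -> (forall y, Omega y -> {for y, continuous f}) ->
  -1 * lineavg (derive1 kappa) (ev q.2) f q.1 - f q.1 @[q --> (x, 0 : R)] --> (0 : R).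
Proof.
move=> Ox cf.
have := cvgB (cvgM (cvg_cst (-1 : R)) (lineavg_limit a ckappa' oO Ox cf)) (cvg_pt (cf _ Ox)).
by rewrite I01_kappa' mulrA mulN1r opprK mul1r subrr; exact.
Qed.

Lemma correction_limit c x : Omega x ->
  correction q.2 c q.1 @[q --> (x, 0 : R)] --> (0 : R).
Proof.
move=> Ox; have lAb b := lA Ox (@cY b).
apply: cvgB0.
  apply: cvgD0; first exact: (cvgM0 (@ldchi a x) (lAb c)).
  exact: (cvgM0 (@lchi x) (lT Ox (@cY c))).
apply: (@cvgM0 _ _ _ _ (fun=> (c == a)%:R)); first exact: cvg_cst.
by apply: cvg_sum0 => b; exact: (cvgM0 (@ldchi b x) (lAb b)).
Qed.

Lemma dcorrection_limit d c x : Omega x ->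
  dcorrection q.2 d c q.1 @[q --> (x, 0 : R)] --> (0 : R).
Proof.
move=> Ox; have lAb b := lA Ox (@cY b); have ldAb b := lA Ox (@cdY b d).
have lS b := cvgD0 (cvgM0 (@ldchi b x) (ldAb b)) (cvgM0 (@lddchi b d x) (lAb b)).
apply: cvgB0.
  apply: cvgD0; first exact: (cvgD0 (cvgM0 (@ldchi a x) (ldAb c))
    (cvgM0 (@lddchi a d x) (lAb c))).
  exact: (cvgD0 (cvgM0 (@lchi x) (lT Ox (@cdY c d)))
    (cvgM0 (@ldchi d x) (lT Ox (@cY c)))).
apply: (@cvgM0 _ _ _ _ (fun=> (c == a)%:R)); first exact: cvg_cst.
by apply: cvg_sum0 => b; exact: lS.
Qed.

End perturbation.

(** * Cutoff functions *)

Section cutoff.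
Context {R : realType}.

Definition bump (t : R) : R := smooth_step (-1 * t + 2) * smooth_step (1 * t + 2).

Lemma smooth_bump : smooth_line bump.
Proof.
move=> k; apply: ClineM; apply: (@Cline_affine _ _ smooth_step);
  exact: smooth_smooth_step.
Qed.

Lemma bump1 (t : R) : `|t| <= 1 -> bump t = 1.
Proof. by rewrite ler_norml => /andP[t1 t2]; rewrite /bump !smooth_step1 ?mulr1//; lra. Qed.

Lemma bump0 (t : R) : 2 <= `|t| -> bump t = 0.
Proof.
rewrite ler_normr => /orP[t2|t2]; rewrite /bump.
  by rewrite smooth_step0 ?mul0r//; lra.
by rewrite [X in _ * X]smooth_step0 ?mulr0//; lra.
Qed.

(** A product of bumps in the coordinates, since the norm of row vectors is the
    maximum norm. *)
Definition cutoff n (x0 : 'rV[R]_n) (r : R) (x : 'rV[R]_n) : R :=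
  \prod_(c < n) bump (r^-1 * x 0 c + - (r^-1 * x0 0 c)).

Lemma Cp_cutoff n (x0 : 'rV[R]_n) r k : Cp predT k setT (cutoff x0 r).
Proof.
apply: Cp_prod; first exact: openT.
by move=> c _; apply: Cp_line; exact: smooth_bump.
Qed.

Lemma cutoff1 n (x0 x : 'rV[R]_n) r : 0 < r -> `|x - x0| <= r -> cutoff x0 r x = 1.
Proof.
move=> r0 xr; rewrite /cutoff big1// => c _; apply: bump1.
rewrite -mulrBr normrM normfV (gtr0_norm r0) ler_pdivrMl// mulr1.
by have := norm_coord (x - x0) c; rewrite !mxE => /le_trans; exact.
Qed.

Lemma cutoff0 n (x0 x : 'rV[R]_n) r : 0 < r -> 2 * r < `|x - x0| -> cutoff x0 r x = 0.
Proof.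
move=> r0 xr.
have [c rc] : exists c, 2 * r < `|(x - x0) 0 c|.
  apply: contrapT => H; move: xr; apply/negP; rewrite -leNgt.
  apply: norm_rV_le => [|c]; first by rewrite mulr_ge0// ltW.
  by rewrite leNgt; apply/negP => ?; apply: H; exists c.
rewrite /cutoff (bigD1 c)//= bump0 ?mul0r//.
rewrite -mulrBr normrM normfV (gtr0_norm r0) ler_pdivlMl// mulrC ltW//.
by move: rc; rewrite !mxE.
Qed.

End cutoff.

(** * The derivative of a determinant *)

Section jacobi.
Context {R : realType} {V : normedModType R}.

Lemma derive_fprod (I : eqType) (r : seq I) (F : I -> V -> R) x v (dF : I -> R) :
  uniq r -> (forall i, is_derive x v (F i) (dF i)) ->
  is_derive x v (fun y => \prod_(i <- r) F i y)
    (\sum_(i <- r) dF i * \prod_(j <- r | j != i) F j x).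
Proof.
move=> + HF; elim: r => [_|i r IH /= /andP[ir ur]].
  rewrite big_nil (_ : (fun _ => _) = cst 1); first exact: is_derive_cst.
  by apply/funext => y; rewrite big_nil.
rewrite (_ : (fun _ => _) = fun y => F i y * \prod_(j <- r) F j y); last first.
  by apply/funext => y; rewrite big_cons.
apply: (is_derive_eq (derive_fM (HF i) (IH ur))).
rewrite big_cons addrC big_cons eqxx/=; congr (_ + _).
  congr (_ * _); rewrite [LHS]big_seq [RHS]big_seq_cond.
  apply: eq_bigl => j; case jr: (j \in r) => //=.
  by apply/esym; apply: contraNneq ir => <-.
rewrite mulr_sumr [LHS]big_seq [RHS]big_seq; apply: eq_bigr => k kr.
rewrite big_cons ifT; first by rewrite mulrCA.
by apply: contraNneq ir => ->.
Qed.

(** Jacobi's formula, with the inverse of [A x] given as [B]. *)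
Lemma derive_det n (A : V -> 'M[R]_n) (B dA : 'M[R]_n) x v :
  (forall i j, is_derive x v (fun y => A y i j) (dA i j)) -> A x *m B = 1%:M ->
  is_derive x v (fun y => \det (A y))
    (\det (A x) * \sum_(i < n) \sum_(j < n) dA i j * B j i).
Proof.
move=> HA AB.
have adjE : \adj (A x) = \det (A x) *: B.
  by rewrite -[LHS]mul1mx -(mulmx1C AB) -mulmxA mul_mx_adj mul_mx_scalar.
(* The rows of [A x], except for the [i]-th one, which is differentiated. *)
pose Ar i : 'M[R]_n := \matrix_(k, l) (if k == i then dA k l else A x k l).
have dS (s : {perm 'I_n}) : is_derive x v (fun y => (-1) ^+ s * \prod_i A y i (s i))
    ((-1) ^+ s * \sum_i dA i (s i) * \prod_(j | j != i) A x j (s j)).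
  apply: derive_fZ; exact: (@derive_fprod _ _ (fun i y => A y i (s i)) x v
    (fun i => dA i (s i)) (index_enum_uniq _) (fun i => HA i (s i))).
apply: (is_derive_eq (derive_fsum (index_enum _) dS)).
transitivity (\sum_i \det (Ar i)).
  under eq_bigr do rewrite mulr_sumr.
  rewrite exchange_big/=; apply: eq_bigr => i _; apply: eq_bigr => s _.
  congr (_ * _); rewrite [RHS](bigD1 i)//= mxE eqxx; congr (_ * _).
  by apply: eq_bigr => j /negPf ji; rewrite mxE ji.
rewrite mulr_sumr; apply: eq_bigr => i _.
rewrite (expand_det_row _ i) mulr_sumr; apply: eq_bigr => j _.
rewrite [Ar i i j]mxE eqxx [RHS]mulrCA; congr (_ * _).
have -> : \det (A x) * B j i = \adj (A x) j i by rewrite adjE mxE.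
rewrite [RHS]mxE /cofactor; congr (_ * \det _).
by apply/matrixP => k l; rewrite !mxE eq_sym (negPf (neq_lift _ _)).
Qed.

End jacobi.

(** * Vector fields under changes of charts *)

Section jacobians.
Context {R : realType}.

Lemma jacobianE n m (f : 'rV[R]_n -> 'rV[R]_m) x c b :
  differentiable f x -> 'J f x c b = pd c (fun y => f y 0 b) x.
Proof.
move=> df /=; rewrite (derive_component b (diff_derivable df)).
by rewrite deriveE// /jacobian mxE.
Qed.

Lemma jacobian_comp n m p (f : 'rV[R]_m -> 'rV[R]_p) (g : 'rV[R]_n -> 'rV[R]_m) x :
  differentiable g x -> differentiable f (g x) ->
  'J (f \o g) x = 'J g x *m 'J f (g x).
Proof.
move=> dg df; apply/row_matrixP => c; rewrite !rowE mulmxA.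
by rewrite /jacobian !mul_rV_lin1 diff_comp.
Qed.

Lemma near_eq_jacobian n m (f g : 'rV[R]_n -> 'rV[R]_m) (x : 'rV[R]_n) :
  (\near x, f x = g x) -> differentiable f x -> differentiable g x ->
  'J f x = 'J g x.
Proof.
move=> fg df dg; apply/matrixP => c b.
transitivity (pd c (fun y => f y 0 b) x); first exact: jacobianE.
transitivity (pd c (fun y => g y 0 b) x); last exact/esym/jacobianE.
by apply: near_eq_derive; move: fg; apply: filterS => y ->.
Qed.

Lemma jacobian_id n (x : 'rV[R]_n) : 'J (@id 'rV[R]_n) x = 1%:M.
Proof.
apply/row_matrixP => c; rewrite !rowE mulmx1.
have dx : differentiable (@id 'rV[R]_n) x by [].
by rewrite -(deriveEjacobian _ dx) derive_id.
Qed.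

End jacobians.

Section charts.
Context {R : realType} {n : nat} (M : smooth_manifold R n).
Implicit Types (i j l : atlas_index M) (x y : 'rV[R]_n).

Notation tr i j := (transition (ch i) (ch j)).
Notation ov i j := (overlap (ch i) (ch j)).

Lemma open_overlap i j : open (ov i j).
Proof.
rewrite openE => x [cx dx]; rewrite /interior; apply: filterI.
  by apply: open_nbhs_nbhs; split; [exact: cod_open|].
apply: (from_continuous cx); apply: open_nbhs_nbhs.
by split => //; exact: dom_open.
Qed.

Lemma overlap_to i j p : dom (ch i) p -> dom (ch j) p -> ov i j (to (ch i) p).
Proof. by move=> ip jp; split; [exact: to_cod|rewrite toK]. Qed.

Lemma transition_to i j p : dom (ch i) p -> tr i j (to (ch i) p) = to (ch j) p.
Proof. by move=> ip; rewrite /transition toK. Qed.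

Lemma overlap_transition i j x : ov i j x -> ov j i (tr i j x).
Proof.
move=> [cx dx]; rewrite -(fromK cx) transition_to; last exact: from_dom.
by apply: overlap_to => //; exact: from_dom.
Qed.

Lemma transitionK i j x : ov i j x -> tr j i (tr i j x) = x.
Proof. by move=> [cx dx]; rewrite /transition (toK dx) fromK. Qed.

Lemma Cp_transition i j k b : Cp predT k (ov i j) (fun x => tr i j x 0 b).
Proof. by apply: Ck_Cp; [exact: open_overlap|exact: ch_compatible]. Qed.

Lemma differentiable_transition i j x : ov i j x -> differentiable (tr i j) x.
Proof.
move=> ox; apply: (Cp_differentiable_rV (@open_overlap i j) ox) => b.
exact: (Cp_transition i j 1).
Qed.

Lemma continuous_transition i j x : ov i j x -> {for x, continuous (tr i j)}.
Proof. by move=> /differentiable_transition/differentiable_continuous. Qed.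

Lemma jacobian_transition i j x c b : ov i j x ->
  'J (tr i j) x c b = pd c (fun y => tr i j y 0 b) x.
Proof. by move=> ox; apply: jacobianE; exact: differentiable_transition. Qed.

Lemma jacobian_cocycle i j l p : dom (ch i) p -> dom (ch j) p -> dom (ch l) p ->
  'J (tr i l) (to (ch i) p) =
  'J (tr i j) (to (ch i) p) *m 'J (tr j l) (to (ch j) p).
Proof.
move=> ip jp lp; have oij := overlap_to ip jp; have oil := overlap_to ip lp.
rewrite -(transition_to j ip) -jacobian_comp; last 2 first.
- exact: differentiable_transition.
- by rewrite transition_to//; apply/differentiable_transition/overlap_to.
apply: near_eq_jacobian.
- apply: filterS (near_of_open (@open_overlap i j) oij) => x [cx dx].
  by rewrite /= /transition (toK dx).
- exact: differentiable_transition.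
- apply: differentiable_comp; first exact: differentiable_transition.
  by rewrite transition_to//; apply/differentiable_transition/overlap_to.
Qed.

Lemma jacobian_inverse i j x : ov i j x ->
  'J (tr i j) x *m 'J (tr j i) (tr i j x) = 1%:M.
Proof.
move=> ox; have ox' := overlap_transition ox.
rewrite -jacobian_comp; [|exact: differentiable_transition..].
rewrite -(jacobian_id x); apply: near_eq_jacobian => //.
  apply: filterS (near_of_open (@open_overlap i j) ox) => y oy.
  exact: transitionK.
by apply: differentiable_comp; exact: differentiable_transition.
Qed.

(** The rule of transformation of the components of a vector field, as a relation
    between two families of functions of the coordinates. It applies both to a
    field and to the difference of two fields. *)
Definition pushed i j (u v : 'I_n -> 'rV[R]_n -> R) := forall y b, ov j i y ->
  v b y = \sum_(c < n) u c (tr j i y) * pd c (fun z => tr i j z 0 b) (tr j i y).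

Lemma local_field_pushed (X : vector_field M) i j :
  pushed i j (fun c x => local_field X i x 0 c) (fun b y => local_field X j y 0 b).
Proof.
move=> y b [cy dy]; have jy := from_dom cy.
rewrite /local_field (component_tangent X dy jy) mxE.
have E : tr j i y = to (ch i) (from (ch j) y) by [].
apply: eq_bigr => c _; rewrite E (toK dy); congr (_ * _).
by rewrite jacobian_transition//; exact: overlap_to.
Qed.

Section push.
Variables (i j : atlas_index M).
Let s := tr j i.
Let D c b : 'rV[R]_n -> R := pd c (fun z => tr i j z 0 b).

Let CD c b k : Cp predT k (ov i j) (D c b).
Proof. exact: Cp_pd (Cp_transition i j k.+1 b) (erefl : c \in predT). Qed.

Lemma open_push (W : set 'rV[R]_n) : open W -> open (ov j i `&` s @^-1` W).
Proof.
move=> oW; rewrite openE => y [oy Wy]; rewrite /interior; apply: filterI.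
  by apply: near_of_open => //; exact: open_overlap.
by apply: (continuous_transition oy); exact: near_of_open.
Qed.

Lemma Cp_push k (W : set 'rV[R]_n) u v b : open W -> pushed i j u v ->
  (forall c, Cp predT k W (u c)) -> Cp predT k (ov j i `&` s @^-1` W) (v b).
Proof.
move=> oW uv CU; have oP := open_push oW.
have Cs c : Cp predT k (ov j i `&` s @^-1` W) (fun y => s y 0 c).
  by apply: Cp_subopen (Cp_transition j i k c) => y [].
apply: (@Cp_eq _ _ _ _ _ (fun y => \sum_(c < n) (u c \o s) y * (D c b \o s) y)) => //.
  by move=> y; rewrite inE => -[oy _]; rewrite uv.
apply: Cp_sum => // c _; apply: CpM => //.
  by apply: (Cp_comp oP oW _ Cs (CU c)) => y [].
apply: (Cp_comp oP (@open_overlap i j) _ Cs (CD c b k)) => y [oy _].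
exact: overlap_transition.
Qed.

Lemma is_derive_push u v b d y : pushed i j u v -> ov j i y ->
  (forall c, differentiable (u c) (s y)) ->
  is_derive y (basis_vec R d) (v b)
    (\sum_(c < n) (u c (s y) * (\sum_(a < n) pd a (D c b) (s y) * pd d (fun z => s z 0 a) y) +
      (\sum_(a < n) pd a (u c) (s y) * pd d (fun z => s z 0 a) y) * D c b (s y))).
Proof.
move=> uv oy du.
have n1 : \near y, \sum_(c < n) (u c \o s) y * (D c b \o s) y = v b y.
  by apply: filterS (near_of_open (@open_overlap j i) oy) => z oz; rewrite uv.
apply: (near_eq_is_derive n1); apply: derive_fsum => c.
have ds : differentiable s y by exact: differentiable_transition.
have dD : differentiable (D c b) (s y).
  apply: (Cp_differentiable (@open_overlap i j)); last exact: CD.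
  exact: overlap_transition.
exact: (derive_fM (is_derive_comp d (du c) ds) (is_derive_comp d dD ds)).
Qed.

(** Convergence to 0 in C^1 near a point does not depend on the chart. The limits
    are taken as the point and the parameter vary together. *)
Lemma push_limit (u v : R -> 'I_n -> 'rV[R]_n -> R) y :
  (forall e, pushed i j (u e) (v e)) -> ov j i y ->
  (\forall q \near (s y, 0 : R), forall c, differentiable (u q.2 c) q.1) ->
  (forall c, u q.2 c q.1 @[q --> (s y, 0 : R)] --> (0 : R)) ->
  (forall c a, pd a (u q.2 c) q.1 @[q --> (s y, 0 : R)] --> (0 : R)) ->
  (forall b, v q.2 b q.1 @[q --> (y, 0 : R)] --> (0 : R)) /\
  (forall b d, pd d (v q.2 b) q.1 @[q --> (y, 0 : R)] --> (0 : R)).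
Proof.
move=> uv oy du lu ldu.
have cfst : (fun q : 'rV[R]_n * R => q.1) @ (y, 0 : R) --> y by exact: cvg_fst.
have csnd : (fun q : 'rV[R]_n * R => q.2) @ (y, 0 : R) --> (0 : R) by exact: cvg_snd.
have cs1 : (fun q : 'rV[R]_n * R => s q.1) @ (y, 0 : R) --> s y.
  exact: (@cvg_comp _ _ _ (fun q : 'rV[R]_n * R => q.1) s _ _ _ cfst
    (continuous_transition oy)).
have cs : (fun q : 'rV[R]_n * R => (s q.1, q.2)) @ (y, 0 : R) --> (s y, 0 : R).
  exact: (cvg_pair cs1 csnd).
have osy := overlap_transition oy.
have lD (f : 'rV[R]_n -> R) : {for s y, continuous f} ->
    f (s q.1) @[q --> (y, 0 : R)] --> f (s y).
  by move=> cf; exact: (@cvg_comp _ _ _ (fun q : 'rV[R]_n * R => s q.1) f _ _ _ cs1 cf).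
have lU c : u q.2 c (s q.1) @[q --> (y, 0 : R)] --> (0 : R).
  exact: (@cvg_comp _ _ _ (fun q : 'rV[R]_n * R => (s q.1, q.2))
    (fun q : 'rV[R]_n * R => u q.2 c q.1) _ _ _ cs (lu c)).
have lDU c a : pd a (u q.2 c) (s q.1) @[q --> (y, 0 : R)] --> (0 : R).
  exact: (@cvg_comp _ _ _ (fun q : 'rV[R]_n * R => (s q.1, q.2))
    (fun q : 'rV[R]_n * R => pd a (u q.2 c) q.1) _ _ _ cs (ldu c a)).
have lDc c b := lD _ (Cp_continuous (CD c b 0) osy).
have lDDc c b a := lD _ (Cp_continuous (Cp_pd (CD c b 1) (erefl : a \in predT)) osy).
have lds a d : pd d (fun z => s z 0 a) q.1 @[q --> (y, 0 : R)] --> pd d (fun z => s z 0 a) y.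
  have := Cp_continuous (Cp_pd (Cp_transition j i 1 a) (erefl : d \in predT)) oy.
  exact: (@cvg_comp _ _ _ (fun q : 'rV[R]_n * R => q.1) _ _ _ _ cfst).
have no : \forall q \near (y, 0 : R), ov j i q.1.
  exact: (cfst _ (near_of_open (@open_overlap j i) oy)).
have nd : \forall q \near (y, 0 : R), forall c, differentiable (u q.2 c) (s q.1).
  exact: cs du.
split.
- move=> b.
  have n1 : {near (y, 0 : R), (fun q : 'rV[R]_n * R =>
      \sum_(c < n) D c b (s q.1) * u q.2 c (s q.1)) =1 (fun q => v q.2 b q.1)}.
    apply: filterS no => q oq; rewrite uv//; apply: eq_bigr => c _.
    by rewrite mulrC.
  apply: cvg_trans (near_eq_cvg n1) _.
  by apply: cvg_sum0 => c; exact: (cvgM0 (lDc c b) (lU c)).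
- move=> b d.
  have n1 : {near (y, 0 : R), (fun q : 'rV[R]_n * R =>
      \sum_(c < n) ((\sum_(a < n) pd a (D c b) (s q.1) * pd d (fun z => s z 0 a) q.1)
         * u q.2 c (s q.1) +
       D c b (s q.1) * (\sum_(a < n) pd d (fun z => s z 0 a) q.1 * pd a (u q.2 c) (s q.1))))
      =1 (fun q => pd d (v q.2 b) q.1)}.
    apply: filterS (filterI no nd) => q [oq dq].
    have [_ ->] := is_derive_push b d (uv q.2) oq dq.
    apply: eq_bigr => c _; congr (_ + _); first by rewrite mulrC.
    rewrite mulrC; congr (_ * _); apply: eq_bigr => a _.
    by rewrite mulrC.
  apply: cvg_trans (near_eq_cvg n1) _.
  apply: cvg_sum0 => c; apply: cvgD0.
    have lS : (\sum_(a < n) pd a (D c b) (s q.1) * pd d (fun z => s z 0 a) q.1)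
        @[q --> (y, 0 : R)] -->
        \sum_(a < n) pd a (D c b) (s y) * pd d (fun z => s z 0 a) y.
      by apply: cvg_bigsum => a; exact: (cvgM (lDDc c b a) (lds a d)).
    exact: (cvgM0 lS (lU c)).
  apply: (cvgM0 (lDc c b)); apply: cvg_sum0 => a.
  exact: (cvgM0 (lds a d) (lDU c a)).
Qed.

End push.

End charts.

(** * Invariance of the divergence *)

Section algebra.
Context {R : realType} {n : nat}.

(** Squares remove the absolute value of the Jacobian determinant, which is not
    known to have a constant sign. *)
Lemma sqr_mul_norm (a d : R) : (a * d) * (a * d) = (a * `|d|) * (a * `|d|).
Proof. by rewrite [LHS]mulrACA [RHS]mulrACA -!expr2 real_normK// num_real. Qed.

Lemma log_derivative_square (a d S L r r' : R) :
  (a * d) * (a * (d * L) + S * d) + (a * (d * L) + S * d) * (a * d) =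
    r * r' + r' * r ->
  (a * d) * (a * d) = r * r -> r != 0 -> a != 0 -> r' / r = S / a + L.
Proof.
move=> E sq r0 a0.
have E' : r * r' = r * r * (S / a + L).
  rewrite -sq; have -> : r * r' = (a * d) * (a * (d * L) + S * d).
    by move: E; move: (a * d) (a * (d * L) + S * d) => p q; rewrite [q * p]mulrC [r' * r]mulrC; lra.
  by field.
have -> : r' = r * (S / a + L).
  by apply: (mulfI r0); rewrite E' mulrA.
by rewrite mulrAC divff// mul1r.
Qed.

(** The linear algebra of the invariance of the divergence at a point: [u] are
    the components of the field in the first chart, [du] their derivatives, [Dm]
    and [Sg] the Jacobian matrices of the two inverse changes of charts, [H] the
    second derivatives, [r] and [w] the second density and its derivatives, and
    [t] the logarithmic derivative of the first density. The second derivatives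
    on the left are compensated by those coming from the Jacobian determinant
    in [t]. *)
Lemma change_of_divergence (u w : 'I_n -> R) (r : R) (du Dm Sg : 'I_n -> 'I_n -> R)
    (H : 'I_n -> 'I_n -> 'I_n -> R) (t : 'I_n -> R) :
  (forall c a, \sum_(b < n) Dm c b * Sg b a = (c == a)%:R) ->
  (forall c, t c = (\sum_(b < n) Dm c b * w b) / r +
     \sum_(b < n) \sum_(a < n) H c b a * Sg b a) ->
  \sum_(b < n) \sum_(c < n) (u c * (\sum_(a < n) H c b a * Sg b a) +
     (\sum_(a < n) du c a * Sg b a) * Dm c b) +
  \sum_(b < n) (\sum_(c < n) u c * Dm c b) * (w b / r) =
  \sum_(c < n) du c c + \sum_(c < n) u c * t c.
Proof.
move=> inv tE.
under eq_bigr do rewrite big_split/=.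
rewrite big_split/= addrAC addrC; congr (_ + _).
  rewrite exchange_big/=; apply: eq_bigr => c _.
  under eq_bigr do rewrite mulr_suml.
  rewrite exchange_big/=.
  rewrite (eq_bigr (fun a => du c a * (c == a)%:R)); last first.
    move=> a _; rewrite -inv mulr_sumr; apply: eq_bigr => b _.
    by rewrite -mulrA [Sg _ _ * _]mulrC.
  rewrite (bigD1 c)//= eqxx mulr1 big1 ?addr0// => a /negPf ac.
  by rewrite eq_sym ac mulr0.
under [in RHS]eq_bigr do rewrite tE mulrDr.
rewrite big_split/= addrC; congr (_ + _).
  under eq_bigr do rewrite mulr_suml.
  rewrite exchange_big/=; apply: eq_bigr => c _.
  rewrite mulrA mulr_sumr mulr_suml; apply: eq_bigr => b _.
  by rewrite !mulrA.
rewrite exchange_big/=; apply: eq_bigr => c _.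
by rewrite mulr_sumr.
Qed.

End algebra.

Section divergence_in_charts.
Context {R : realType} {n : nat} (M : smooth_manifold R n) (m : smooth_volume M).
Implicit Types (i j l : atlas_index M) (x y : 'rV[R]_n) (X : vector_field M).

Notation tr i j := (transition (ch i) (ch j)).
Notation ov i j := (overlap (ch i) (ch j)).
Notation D i j c b := (pd c (fun z => tr i j z 0 b)).

Lemma Cp_density l k : Cp predT k (cod (ch l)) (local_density m l).
Proof. by apply: Ck_Cp_scalar; exact: density_smooth. Qed.

Lemma local_density_gt0 l x : cod (ch l) x -> 0 < local_density m l x.
Proof. by move=> cx; apply: density_gt0; exact: from_dom. Qed.

Lemma is_derive_density l c x : cod (ch l) x ->
  is_derive x (basis_vec R c) (local_density m l) (pd c (local_density m l) x).
Proof. by move=> cx; apply: (Cp_is_derive (Cp_density l 1)). Qed.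

Lemma divergenceE X l x : cod (ch l) x ->
  (forall c, differentiable (fun z => local_field X l z 0 c) x) ->
  divergence m X l x = \sum_(c < n) pd c (fun z => local_field X l z 0 c) x +
    \sum_(c < n) local_field X l x 0 c *
      (pd c (local_density m l) x / local_density m l x).
Proof.
move=> cx dX; rewrite /divergence mulr_sumr -big_split/=; apply: eq_bigr => c _.
have dXc : is_derive x (basis_vec R c) (fun z => local_field X l z 0 c)
    (pd c (fun z => local_field X l z 0 c) x).
  by apply: derivableP; exact: diff_derivable.
have [_ E] := derive_fM (is_derive_density c cx) dXc.
rewrite [X in _^-1 * X](_ : _ = local_density m l x * pd c (fun z => local_field X l z 0 c) x +
  pd c (local_density m l) x * local_field X l x 0 c); last exact: E.
have rn0 : local_density m l x != 0 by rewrite gt_eqF// local_density_gt0.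
rewrite mulrDr mulKf//; congr (_ + _).
by rewrite mulrC -mulrA mulrCA.
Qed.

Lemma inverse_entries i j x c a : ov i j x ->
  \sum_(b < n) D i j c b x * D j i b a (tr i j x) = (c == a)%:R.
Proof.
move=> ox; have := congr1 (fun A : 'M[R]_n => A c a) (jacobian_inverse ox).
rewrite !mxE => <-; apply: eq_bigr => b _; congr (_ * _); apply/esym.
  exact: jacobian_transition.
exact/jacobian_transition/overlap_transition.
Qed.

(** By Jacobi's formula, the logarithmic derivative of the Jacobian determinant,
    in the direction [c]. *)
Definition log_jacobian i j c x : R :=
  \sum_(b < n) \sum_(a < n) pd a (D i j c b) x * D j i b a (tr i j x).

(** Jacobi's formula, and the symmetry of second derivatives to put the result in
    the form in which it meets the second derivatives of
    [change_of_divergence]. *)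
Lemma derive_det_transition i j c x : ov i j x ->
  is_derive x (basis_vec R c) (fun z => \det ('J (tr i j) z))
    (\det ('J (tr i j) x) * log_jacobian i j c x).
Proof.
move=> ox; have oO := @open_overlap _ _ M i j.
pose J' : 'M[R]_n := \matrix_(a, b) pd c (D i j a b) x.
have J'E a b : J' a b = pd c (D i j a b) x by rewrite mxE.
have dA a b : is_derive x (basis_vec R c) (fun z => 'J (tr i j) z a b) (J' a b).
  have n1 : \near x, D i j a b x = 'J (tr i j) x a b.
    by apply: filterS (near_of_open oO ox) => z oz; exact/esym/jacobian_transition.
  apply: (near_eq_is_derive n1); rewrite J'E.
  exact: Cp_is_derive (Cp_pd (Cp_transition i j 2 b) (erefl : a \in predT)) _ ox.
apply: (is_derive_eq (derive_det dA (jacobian_inverse ox))).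
congr (_ * _); rewrite exchange_big/=; apply: eq_bigr => b _; apply: eq_bigr => a _.
congr (_ * _); last exact/jacobian_transition/overlap_transition.
transitivity (pd c (D i j a b) x); first exact: J'E.
exact: (pd_commute _ _ oO ox (Cp_transition i j 2 b)).
Qed.

Lemma density_transition i j x : ov i j x ->
  local_density m i x =
  local_density m j (tr i j x) * `|\det ('J (tr i j) x)|.
Proof.
move=> [cx dx]; have ix := from_dom cx.
rewrite /local_density (density_change m ix dx).
by rewrite /transition (toK dx) fromK.
Qed.

Lemma log_density_transition i j c x : ov i j x ->
  pd c (local_density m i) x / local_density m i x =
  (\sum_(b < n) D i j c b x * pd b (local_density m j) (tr i j x))
    / local_density m j (tr i j x) + log_jacobian i j c x.
Proof.
move=> ox; have oO := @open_overlap _ _ M i j.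
have ox' := overlap_transition ox.
set ri := local_density m i; set rj := local_density m j.
have dri := is_derive_density c ox.1.
have dr : is_derive x (basis_vec R c) (rj \o tr i j)
    (\sum_(b < n) pd b rj (tr i j x) * D i j c b x).
  apply: is_derive_comp; last exact: differentiable_transition.
  apply: (@Cp_differentiable _ _ _ (cod (ch j))); first exact: cod_open.
    by case: ox'.
  exact: Cp_density.
have ddet := derive_det_transition c ox.
have n1 : \near x, (((rj \o tr i j) x * \det ('J (tr i j) x)) *
    ((rj \o tr i j) x * \det ('J (tr i j) x))) = ri x * ri x.
  apply: filterS (near_of_open oO ox) => z oz.
  rewrite /ri (density_transition oz); exact: sqr_mul_norm.
have drr := derive_fM dr ddet.
have [_ E1] := near_eq_is_derive n1 (derive_fM drr drr).
have [_ E2] := derive_fM dri dri.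
have E := etrans (esym E1) E2.
have ri0 : ri x != 0 by rewrite gt_eqF// local_density_gt0//; exact: ox.1.
have rj0 : (rj \o tr i j) x != 0 by rewrite gt_eqF// local_density_gt0//; exact: ox'.1.
have sq : (rj \o tr i j) x * \det ('J (tr i j) x) *
  ((rj \o tr i j) x * \det ('J (tr i j) x)) = ri x * ri x := nbhs_singleton n1.
have -> : \sum_(b < n) D i j c b x * pd b rj (tr i j x) =
    \sum_(b < n) pd b rj (tr i j x) * D i j c b x.
  by apply: eq_bigr => b _; rewrite mulrC.
exact: (log_derivative_square E sq ri0 rj0).
Qed.

(** The divergence is defined chart by chart; a field that is modified within one
    chart must stay divergence free in all the others. This holds already for
    differentiable fields, because a change of charts is smooth. *)
Lemma divergence_push X i j y : ov j i y ->
  (forall c, differentiable (fun x => local_field X i x 0 c) (tr j i y)) ->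
  (forall b, differentiable (fun z => local_field X j z 0 b) y) ->
  divergence m X j y = divergence m X i (tr j i y).
Proof.
move=> oy dX dXj'; set x := tr j i y; have ox : ov i j x := overlap_transition oy.
have yE : tr i j x = y by exact: transitionK.
have P := @local_field_pushed _ _ M X i j.
have dXj b d := is_derive_push b d P oy dX.
rewrite (divergenceE oy.1 dXj') (divergenceE ox.1 dX).
under eq_bigr => b _ do rewrite (@derive_val _ _ _ _ _ _ _ (dXj b b)).
under [X in _ + X]eq_bigr => b _ do rewrite (P y b oy).
apply: (@change_of_divergence _ _ (fun c => local_field X i x 0 c)
  (fun b => pd b (local_density m j) y) (local_density m j y)
  (fun c a => pd a (fun z => local_field X i z 0 c) x)
  (fun c b => D i j c b x) (fun b a => D j i b a y)
  (fun c b a => pd a (D i j c b) x)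
  (fun c => pd c (local_density m i) x / local_density m i x)) => [c a|c].
  by have := inverse_entries c a ox; rewrite yE.
by have := log_density_transition c ox; rewrite /log_jacobian yE.
Qed.

End divergence_in_charts.

(** * Local regularity, and fields modified within a chart *)

Section regularity.
Context {R : realType} {n : nat}.
Implicit Types (S : {pred 'I_n}) (K : set nat) (F : 'rV[R]_n -> 'rV[R]_n).

(** The set [K] of orders is quantified inside the neighbourhood, so that with
    [K = setT] a single neighbourhood serves all orders. *)
Definition regular S K F (x : 'rV[R]_n) := exists U : set 'rV[R]_n,
  [/\ open U, U x & forall k, K k -> forall c, Cp S k U (fun z => F z 0 c)].

Lemma regular_sub S S' K K' F x : {subset S' <= S} -> K' `<=` K ->
  regular S K F x -> regular S' K' F x.
Proof.
move=> SS KK [U [oU Ux CU]]; exists U; split => // k /KK Kk c.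
exact: Cp_subset (CU k Kk c).
Qed.

Lemma regular_eq S K F F' (x : 'rV[R]_n) : (\forall z \near x, F z = F' z) ->
  regular S K F x -> regular S K F' x.
Proof.
move=> /nbhs_ballP[r /= r0 FF] [U [oU Ux CU]].
exists (U `&` ball x r); split.
- by apply: openI => //; exact: ball_open.
- by split => //; exact: ballxx.
- move=> k Kk c; apply: (@Cp_eq _ _ _ _ _ (fun z => F z 0 c)).
  + by apply: openI => //; exact: ball_open.
  + by move=> z; rewrite inE => -[_ /FF ->].
  + by apply: Cp_subopen (CU k Kk c) => z [].
Qed.

Lemma regular_Ck k (U : set 'rV[R]_n) K F : open U -> K k ->
  (forall x, U x -> regular predT K F x) -> Ck k U F.
Proof.
move=> oU Kk H; apply: Cp_Ck => // b; apply: Cp_local => x /H[V [_ Vx CV]].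
by exists V; split => //; exact: CV.
Qed.

Lemma Ck_regular k (U : set 'rV[R]_n) F x : open U -> U x -> Ck k U F ->
  regular predT [set k] F x.
Proof. by move=> oU Ux CF; exists U; split => // _ -> c; exact: Ck_Cp. Qed.

Lemma regular_differentiable F x c : regular predT [set 1%N] F x ->
  differentiable (fun z => F z 0 c) x.
Proof. by move=> [U [oU Ux CU]]; apply: (Cp_differentiable oU Ux); exact: CU. Qed.

Lemma regular_differentiable_rV F x : regular predT [set 1%N] F x ->
  differentiable F x.
Proof.
by move=> [U [oU Ux CU]]; apply: (Cp_differentiable_rV oU Ux) => b; exact: CU.
Qed.

Lemma norm_mx_le p q (A : 'M[R]_(p, q)) (e : R) : 0 <= e ->
  (forall b c, `|A b c| <= e) -> `|A| <= e.
Proof.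
by move=> e0 H; rewrite /Num.norm/= mx_normrE; apply: bigmax_le => // -[b c] _.
Qed.

Lemma mx_subE p q (A B : 'M[R]_(p, q)) b c : (A - B) b c = A b c - B b c.
Proof. by rewrite !mxE. Qed.

Lemma Cp_pred0 k (U : set 'rV[R]_n) (f : 'rV[R]_n -> R) :
  (forall x, U x -> {for x, continuous f}) -> Cp pred0 k U f.
Proof. by case: k => [|k] cf; split. Qed.

Lemma compact_closed_ball (z : 'rV[R]_n) (d : R) : 0 < d ->
  compact [set x | `|x - z| <= d].
Proof.
move=> d0; have E : [set x | `|x - z| <= d] = closed_ball z d.
  rewrite closed_ballE//; apply/seteqP.
  by split => x; rewrite /closed_ball_ /= distrC.
apply: bounded_closed_compact; last by rewrite E; exact: closed_ball_closed.
exists (d + `|z|); split; first exact: num_real.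
move=> b db x /= xd; apply: le_trans (ltW db).
by rewrite -[x](subrK z) (le_trans (ler_normD _ _))// lerD2r.
Qed.

Lemma segments_near (a : 'I_n) (W : set 'rV[R]_n) x : open W -> W x ->
  exists V (d : R), [/\ open V, V x, 0 < d & forall e z, `|e| < d -> V z ->
    segment_in (e *: basis_vec R a) W z].
Proof.
move=> oW Wx; have /nbhs_ballP[r /= r0 xW] := near_of_open oW Wx.
exists (ball x (r / 2)), (r / 2).
have r20 : 0 < r / 2 by rewrite divr_gt0.
split => //; [exact: ball_open|exact: ballxx|].
move=> e z er xz u /andP[u0 u1]; apply: xW.
move: xz; rewrite -!ball_normE /= => xz; rewrite opprD addrA.
rewrite (le_lt_trans (ler_normB _ _))// (splitr r) ltr_leD//.
rewrite !normrZ (ger0_norm u0); apply: le_trans (ltW er).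
rewrite -[leRHS]mul1r ler_pM// -[leRHS]mulr1 ler_pM//.
exact: norm_basis_vec.
Qed.

End regularity.

Section adding_a_local_field.
Context {R : realType} {n : nat} {M : smooth_manifold R n}.
Implicit Types (i j l : atlas_index M) (X : vector_field M)
  (phi : 'rV[R]_n -> 'rV[R]_n).

Notation tr i j := (transition (ch i) (ch j)).
Notation ov i j := (overlap (ch i) (ch j)).

(** A field given in the chart [i] is transported to the other charts by the
    Jacobian matrices, and by 0 outside the domain of [i]. The result is a vector
    field in any case; it is regular when [phi] vanishes outside a compact part
    of the chart. *)
Definition added_component X i (phi : 'rV[R]_n -> 'rV[R]_n) (p : M) j : 'rV[R]_n :=
  X p j + (if `[< dom (ch i) p >]
           then phi (to (ch i) p) *m 'J (tr i j) (to (ch i) p) else 0).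

Lemma added_component_tangent X i phi (p : M) :
  tangent_vector p (added_component X i phi p).
Proof.
move=> j l jp lp; rewrite /added_component (component_tangent X jp lp) mulmxDl.
congr (_ + _); case: asboolP => [ip|_]; last by rewrite mul0mx.
by rewrite -mulmxA -(jacobian_cocycle ip jp lp).
Qed.

Definition add_field X i phi : vector_field M :=
  VectorField (@added_component_tangent X i phi).

Lemma add_field_in X i phi (p : M) j : dom (ch i) p ->
  add_field X i phi p j = X p j + phi (to (ch i) p) *m 'J (tr i j) (to (ch i) p).
Proof. by move=> ip; rewrite /= /added_component; case: asboolP. Qed.

Lemma add_field_out X i phi (p : M) j :
  (dom (ch i) p -> phi (to (ch i) p) = 0) -> add_field X i phi p j = X p j.
Proof.
move=> H; rewrite /= /added_component; case: asboolP => [/H ->|_]; rewrite ?addr0//.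
by rewrite mul0mx addr0.
Qed.

Lemma jacobian_self i x : cod (ch i) x -> 'J (tr i i) x = 1%:M.
Proof.
move=> cx; have oii : ov i i x by split => //; exact: from_dom.
rewrite -(jacobian_id x); apply: near_eq_jacobian => //.
  have := near_of_open (@cod_open _ _ _ (ch i)) cx.
  by apply: filterS => z cz; exact: (fromK cz).
exact: differentiable_transition.
Qed.

Lemma local_add_field X i phi x : cod (ch i) x ->
  local_field (add_field X i phi) i x = local_field X i x + phi x.
Proof.
move=> cx; rewrite /local_field add_field_in; last exact: from_dom.
by rewrite fromK// jacobian_self// mulmx1.
Qed.

Lemma add_field_pushed X i j phi : pushed i j (fun c x => phi x 0 c)
  (fun b y => local_field (add_field X i phi) j y 0 b - local_field X j y 0 b).
Proof.
move=> y b [cy dy]; rewrite /local_field add_field_in// mxE addrAC subrr add0r mxE.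
have E : tr j i y = to (ch i) (from (ch j) y) by [].
apply: eq_bigr => c _; rewrite -E; congr (_ * _).
by apply: jacobian_transition; apply: overlap_transition.
Qed.

Lemma regular_push X K i j (p : M) : dom (ch i) p -> dom (ch j) p ->
  regular predT K (local_field X i) (to (ch i) p) ->
  regular predT K (local_field X j) (to (ch j) p).
Proof.
move=> ip jp [U [oU Ux CU]].
exists (ov j i `&` (tr j i) @^-1` U); split.
- exact: open_push.
- by split; [exact: overlap_to|rewrite /= transition_to].
- move=> k Kk b.
  exact: (Cp_push b oU (@local_field_pushed _ _ M X i j) (CU k Kk)).
Qed.

Lemma near_from i (P : M -> Prop) x : cod (ch i) x ->
  (\forall p \near from (ch i) x, P p) -> \forall z \near x, P (from (ch i) z).
Proof. by move=> cx; exact: (from_continuous cx). Qed.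

Lemma compact_from_image j (A : set 'rV[R]_n) : compact A -> A `<=` cod (ch j) ->
  compact (from (ch j) @` A).
Proof.
move=> cA Aj; apply: continuous_compact => //.
by apply: continuous_in_subspaceT => x; rewrite inE => /Aj; exact: from_continuous.
Qed.

Lemma divergence_near_eq (m : smooth_volume M) (X' X'' : vector_field M) j (y : 'rV[R]_n) :
  (\forall z \near y, local_field X' j z = local_field X'' j z) ->
  divergence m X' j y = divergence m X'' j y.
Proof.
move=> XX; rewrite /divergence; congr (_ * _); apply: eq_bigr => c _.
by apply: near_eq_derive; move: XX; apply: filterS => z ->.
Qed.

Definition smooth_point X (p : M) := exists2 j, dom (ch j) p &
  regular predT setT (local_field X j) (to (ch j) p).

Lemma smooth_point_chart X (p : M) j : smooth_point X p ->
  dom (ch j) p -> regular predT setT (local_field X j) (to (ch j) p).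
Proof. by move=> [l lp Rl] jp; exact: regular_push Rl. Qed.

Lemma smooth_point_near X (p : M) : smooth_point X p ->
  \forall q \near p, smooth_point X q.
Proof.
move=> [l lp [U [oU Up CU]]].
have n1 : \forall q \near p, dom (ch l) q.
  by apply: open_nbhs_nbhs; split => //; exact: dom_open.
have n2 : \forall q \near p, U (to (ch l) q).
  by apply: (to_continuous lp); exact: near_of_open.
apply: filterS (filterI n1 n2) => q [lq Uq].
by exists l => //; exists U.
Qed.

End adding_a_local_field.

(** * The smoothing step on the manifold *)

Section smoothing_step.
Context {R : realType} {n : nat} {M : smooth_manifold R n}.
Variables (m : smooth_volume M) (X : vector_field M) (i : atlas_index M)
  (x0 : 'rV[R]_n) (r : R) (a : 'I_n).
Hypotheses (r0 : 0 < r) (x0r : forall x, `|x - x0| <= 2 * r -> cod (ch i) x)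
  (consX : conservative_C1 m X).
Implicit Types (j l : atlas_index M) (S : {pred 'I_n}) (p : M) (x : 'rV[R]_n).

Notation tr i j := (transition (ch i) (ch j)).
Notation ov i j := (overlap (ch i) (ch j)).

Let Omega : set 'rV[R]_n := cod (ch i).
Let rho := local_density m i.
Let chi : 'rV[R]_n -> R := cutoff x0 r.
(** The field [X] is conservative exactly when the product of its components with
    the density has zero Euclidean divergence. *)
Let Y (c : 'I_n) (x : 'rV[R]_n) : R := rho x * local_field X i x 0 c.
Let corr := correction a Y chi.

Definition local_correction (e : R) (x : 'rV[R]_n) : 'rV[R]_n :=
  \row_c ((rho x)^-1 * corr e c x).

Definition smoothed_field (e : R) : vector_field M :=
  add_field X i (local_correction e).

Let oO : open Omega. Proof. exact: cod_open. Qed.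

Let rho_neq0 x : Omega x -> rho x != 0.
Proof. by move=> Ox; rewrite gt_eqF// local_density_gt0. Qed.

Let Crho S k : Cp S k Omega rho.
Proof. by apply: Cp_subset (Cp_density m i k). Qed.

Let Crhoi S k : Cp S k Omega (fun x => (rho x)^-1).
Proof. by apply: CpV => //; exact: rho_neq0. Qed.

Let CX c : Cp predT 1 Omega (fun x => local_field X i x 0 c).
Proof. by apply: Ck_Cp => //; exact: consX.1. Qed.

Let CY c : Cp predT 1 Omega (Y c). Proof. exact: CpM. Qed.

Let Cchi k : Cp predT k setT chi. Proof. exact: Cp_cutoff. Qed.

Let divY y : Omega y -> \sum_(c < n) pd c (Y c) y = 0.
Proof.
move=> Oy; have := consX.2 i y Oy; rewrite /divergence.
by move=> /eqP; rewrite mulf_eq0 invr_eq0 (negPf (rho_neq0 Oy)) => /eqP.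
Qed.

Lemma local_smoothed_field e x c : Omega x ->
  local_field (smoothed_field e) i x 0 c =
  local_field X i x 0 c + (rho x)^-1 * corr e c x.
Proof. by move=> Ox; rewrite local_add_field// !mxE. Qed.

Let bigball : set 'rV[R]_n := [set x | `|x - x0| <= 2 * r].
(** A compact part of the chart; being closed in the Hausdorff space [M], its
    complement is an open set on which the field does not change. *)
Let support : set M := from (ch i) @` bigball.

Let closed_bigball : closed bigball.
Proof.
apply: compact_closed; first exact: norm_hausdorff.
by apply: compact_closed_ball; rewrite mulr_gt0.
Qed.

Let open_outside : open (~` support).
Proof.
apply: closed_openC; apply: compact_closed; first exact: carrier_hausdorff.
apply: compact_from_image; last by move=> x; exact: x0r.
by apply: compact_closed_ball; rewrite mulr_gt0.
Qed.

Let local_correction0 e x : ~ bigball x -> local_correction e x = 0.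
Proof.
move=> xK; apply/rowP => c; rewrite !mxE /corr correction_local ?mulr0//.
have : \forall z \near x, ~ bigball z.
  by apply: open_nbhs_nbhs; split => //; exact: closed_openC.
by apply: filterS => z /negP; rewrite -ltNge; exact: cutoff0.
Qed.

Lemma smoothed_outside e p j : (~` support) p -> smoothed_field e p j = X p j.
Proof.
move=> pL; apply: add_field_out => ip; apply: local_correction0 => pK.
by apply: pL; exists (to (ch i) p) => //; exact: toK.
Qed.

Let near_outside e j (y : 'rV[R]_n) : cod (ch j) y -> (~` support) (from (ch j) y) ->
  \forall z \near y, local_field X j z = local_field (smoothed_field e) j z.
Proof.
move=> cy yL; have : \forall q \near from (ch j) y, (~` support) q.
  by apply: open_nbhs_nbhs.
move=> /(near_from cy); apply: filterS => z zL.
by rewrite /local_field smoothed_outside.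
Qed.

(** The correction at [x] involves the values of [X] on the segment from [x] to
    [x + eps e_a]: a loss of domain that is harmless near a given point for small
    [eps]. *)
Let near_segments (W : set 'rV[R]_n) x : open W -> W x ->
  exists V : set 'rV[R]_n, [/\ open V, V `<=` W & \forall q \near (x, 0 : R), V q.1 /\
    forall z, V z -> segment_in (q.2 *: basis_vec R a) W z].
Proof.
move=> oW Wx; have [V [d [oV Vx d0 VW]]] := segments_near a oW Wx.
exists V; split => //.
  move=> z Vz; have d0' : `|0 : R| < d by rewrite normr0.
  by have := VW 0 z d0' Vz 0; rewrite !scale0r addr0 lexx ler01; exact.
have n1 : \forall z \near x, V z by exact: near_of_open.
have n2 : \forall e \near (0 : R), `|e| < d by exact: (@nbhs0_lt _ R _ d0).
have c1 : (fun q : 'rV[R]_n * R => q.1) @ (x, 0 : R) --> x by exact: cvg_fst.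
have c2 : (fun q : 'rV[R]_n * R => q.2) @ (x, 0 : R) --> (0 : R) by exact: cvg_snd.
have N1 := c1 _ n1; have N2 := c2 _ n2.
near=> q; have Vq : V q.1 by near: q; exact: N1.
have qd : `|q.2| < d by near: q; exact: N2.
by split => // z; exact: VW.
Unshelve. all: by end_near. Qed.

Lemma regular_smoothed S (K : set nat) x : Omega x ->
  regular S K (local_field X i) x ->
  \forall q \near (x, 0 : R), regular S K (local_field (smoothed_field q.2) i) q.1.
Proof.
move=> Ox [U [oU Ux CU]].
have [V [oV VW NV]] := near_segments (openI oU oO) (conj Ux Ox).
apply: (@filterS _ _ (nbhs_filter (x, 0 : R)) _ _ _ NV) => q [Vq Vseg].
exists V; split => // k Kk c.
have VU : V `<=` U by move=> z /VW[].
have VO : V `<=` Omega by move=> z /VW[].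
apply: (@Cp_eq _ _ _ _ _ (fun z => local_field X i z 0 c + (rho z)^-1 * corr q.2 c z)) => //.
  by move=> z; rewrite inE => /VO Oz; rewrite local_smoothed_field.
apply: CpD => //; first exact: Cp_subopen VU (CU k Kk c).
apply: CpM => //; first exact: Cp_subopen VO (Crhoi S k).
apply: (@correction_Cp _ _ _ _ _ Cchi (U `&` Omega)) => //; first exact: openI.
move=> b; apply: CpM; first exact: openI.
- by apply: Cp_subopen (Crho S k) => z [].
- by apply: Cp_subopen (CU k Kk b) => z [].
Qed.

Lemma regular_gain S x : Omega x -> `|x - x0| < r ->
  regular S setT (local_field X i) x ->
  \forall q \near (x, 0 : R), q.2 != 0 ->
    regular [predU1 a & S] setT (local_field (smoothed_field q.2) i) q.1.
Proof.
move=> Ox xr [U [oU Ux CU]].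
have oB : open (ball x0 r) by exact: ball_open.
have Bx : ball x0 r x by rewrite -ball_normE /= distrC.
have [V [oV VW NV]] := near_segments (openI (openI oU oO) oB) (conj (conj Ux Ox) Bx).
apply: (@filterS _ _ (nbhs_filter (x, 0 : R)) _ _ _ NV) => q [Vq Vseg] q0.
exists V; split => // k Kk c.
have VO : V `<=` Omega by move=> z /VW[[]].
apply: (@Cp_eq _ _ _ _ _ (fun z => (rho z)^-1 * (Y c z + corr q.2 c z))) => //.
  move=> z; rewrite inE => /VO Oz; rewrite local_smoothed_field// mulrDr.
  by rewrite /Y mulKf// rho_neq0.
apply: CpM => //; first exact: Cp_subopen VO (Crhoi _ k).
apply: (@corrected_gain _ _ _ _ _ (U `&` Omega)) => //; first exact: openI.
- apply: CpM; first exact: openI.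
  + by apply: Cp_subopen (Crho S k) => z [].
  + by apply: Cp_subopen (CU k Kk c) => z [].
- by move=> z /Vseg zW u /zW[].
- move=> z /VW[_]; rewrite -ball_normE /= distrC => zr.
  by apply: cutoff1 => //; exact: ltW.
Qed.

Lemma divergence_smoothed x : Omega x ->
  \forall q \near (x, 0 : R), divergence m (smoothed_field q.2) i q.1 = 0.
Proof.
move=> Ox; have [V [oV VO NV]] := near_segments oO Ox.
apply: (@filterS _ _ (nbhs_filter (x, 0 : R)) _ _ _ NV) => q [Vq Vseg].
rewrite /divergence -/rho.
have E c : 'D_(basis_vec R c) (fun y => rho y *
      local_field (smoothed_field q.2) i y 0 c) q.1 =
    pd c (Y c) q.1 + pd c (corr q.2 c) q.1.
  have [dc _] := is_derive_correction oO CY Cchi c c (Vseg _ Vq).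
  have dYc := Cp_derivable (CY c) (erefl : c \in predT) (VO _ Vq).
  have [_ <-] := derive_fD (derivableP dYc) (derivableP dc).
  apply: near_eq_derive; apply: filterS (near_of_open oV Vq) => z /VO Oz.
  by rewrite local_smoothed_field// mulrDr mulrA divff ?mul1r// rho_neq0.
rewrite (eq_bigr _ (fun c _ => E c)) big_split/= divY; last exact: VO.
by rewrite (correction_divergence oO CY Cchi divY (Vseg _ Vq)) addr0 mulr0.
Qed.

Lemma local_correction_small x : Omega x ->
  [/\ forall c, local_correction q.2 q.1 0 c @[q --> (x, 0 : R)] --> (0 : R),
      forall c d, pd d (fun z => local_correction q.2 z 0 c) q.1
        @[q --> (x, 0 : R)] --> (0 : R) &
      \forall q \near (x, 0 : R),
        forall c, differentiable (fun z => local_correction q.2 z 0 c) q.1].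
Proof.
move=> Ox; have [V [oV VO NV]] := near_segments oO Ox.
have cfst : (fun q : 'rV[R]_n * R => q.1) @ (x, 0 : R) --> x by exact: cvg_fst.
have pt (f : 'rV[R]_n -> R) : {for x, continuous f} -> f q.1 @[q --> (x, 0 : R)] --> f x.
  by move=> cf; exact: (@cvg_comp _ _ _ (fun q : 'rV[R]_n * R => q.1) f _ _ _ cfst cf).
have l1 := pt _ (Cp_continuous (Crhoi predT 0) Ox).
have l2 d := pt _ (Cp_continuous (Cp_pd (Crhoi predT 1) (erefl : d \in predT)) Ox).
have l3 c := correction_limit a oO CY Cchi c Ox.
have l4 c d := dcorrection_limit a oO CY Cchi d c Ox.
have E e c : (fun z => local_correction e z 0 c) = (fun z => (rho z)^-1 * corr e c z).
  by apply/funext => z; rewrite mxE.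
split.
- move=> c; rewrite (_ : (fun _ => _) = (fun q => (rho q.1)^-1 * corr q.2 c q.1)).
    exact: (cvgM0 l1 (l3 c)).
  by apply/funext => q; rewrite mxE.
- move=> c d.
  have n1 : {near (x, 0 : R), (fun q : 'rV[R]_n * R =>
      (rho q.1)^-1 * dcorrection a Y chi q.2 d c q.1 +
      pd d (fun z => (rho z)^-1) q.1 * corr q.2 c q.1) =1
      (fun q => pd d (fun z => local_correction q.2 z 0 c) q.1)}.
    apply: (@filterS _ _ (nbhs_filter (x, 0 : R)) _ _ _ NV) => q [Vq Vseg].
    rewrite E; have drhoi := Cp_is_derive (Crhoi predT 1) (erefl : d \in predT) (VO _ Vq).
    have dcorr := is_derive_correction oO CY Cchi c d (Vseg _ Vq).
    by have [_ ->] := derive_fM drhoi dcorr.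
  apply: cvg_trans (near_eq_cvg n1) _.
  exact: (cvgD0 (cvgM0 l1 (l4 c d)) (cvgM0 (l2 d) (l3 c))).
- apply: (@filterS _ _ (nbhs_filter (x, 0 : R)) _ _ _ NV) => q [Vq Vseg] c.
  rewrite E; apply: (Cp_differentiable oV Vq); apply: CpM => //.
    exact: Cp_subopen VO (Crhoi predT 1).
  by apply: (@correction_Cp _ _ _ _ _ Cchi Omega).
Qed.

(** All the properties of the smoothed field are stated near [(p, 0)] in the
    product of the manifold with the line of parameters, and compactness of [M]
    will make one small parameter fit for all points. *)
Let near_chart p (P : 'rV[R]_n * R -> Prop) : dom (ch i) p ->
  (\forall q \near (to (ch i) p, 0 : R), P q) ->
  \forall q \near (p, 0 : R), dom (ch i) q.1 /\ P (to (ch i) q.1, q.2).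
Proof.
move=> ip NP; have n1 : \forall q \near p, dom (ch i) q.
  by apply: open_nbhs_nbhs; split => //; exact: dom_open.
have c1 : (fun q : M * R => q.1) @ (p, 0 : R) --> p by exact: cvg_fst.
have c2 : (fun q : M * R => q.2) @ (p, 0 : R) --> (0 : R) by exact: cvg_snd.
have c3 : (fun q : M * R => to (ch i) q.1) @ (p, 0 : R) --> to (ch i) p.
  exact: (@cvg_comp _ _ _ (fun q : M * R => q.1) (to (ch i)) _ _ _ c1 (to_continuous ip)).
have c4 : (fun q : M * R => (to (ch i) q.1, q.2)) @ (p, 0 : R) --> (to (ch i) p, 0 : R).
  exact: (cvg_pair c3 c2).
by apply: filterI; [exact: (c1 _ n1)|exact: (c4 _ NP)].
Qed.

Let near_fst (T : topologicalType) (t : T) (P : T -> Prop) :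
  (\forall q \near t, P q) -> \forall q \near (t, 0 : R), P q.1.
Proof.
have c1 : (fun q : T * R => q.1) @ (t, 0 : R) --> t by exact: cvg_fst.
by move=> NP; exact: (c1 _ NP).
Qed.

Let outside_support p : ~ dom (ch i) p -> (~` support) p.
Proof. by move=> ip [x /x0r cx xp]; apply: ip; rewrite -xp; exact: from_dom. Qed.

Let in_support p : ~ (~` support) p -> dom (ch i) p.
Proof. by move=> H; apply: contrapT => ip; apply: H; exact: outside_support. Qed.

Let near_outside_to e j p : dom (ch j) p -> (~` support) p ->
  \forall z \near to (ch j) p, local_field X j z = local_field (smoothed_field e) j z.
Proof. by move=> jp pL; apply: near_outside; [exact: to_cod|rewrite toK]. Qed.

Let regularX j (y : 'rV[R]_n) : cod (ch j) y -> regular predT [set 1%N] (local_field X j) y.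
Proof.
move=> cy; apply: (Ck_regular _ cy); first exact: cod_open.
exact: consX.1.
Qed.

(** A point is either off the support, where nothing changes, or in the chart
    [i], where the local statements hold; these are then transported to the
    other charts. The next two lemmas follow the same pattern. *)
Lemma conservative_near p : \forall q \near (p, 0 : R), forall j, dom (ch j) q.1 ->
  regular predT [set 1%N] (local_field (smoothed_field q.2) j) (to (ch j) q.1) /\
  divergence m (smoothed_field q.2) j (to (ch j) q.1) = 0.
Proof.
have [pL|/in_support ip] := pselect ((~` support) p).
  have N : \forall q \near (p, 0 : R), (~` support) q.1.
    by apply: near_fst; apply: open_nbhs_nbhs.
  apply: (@filterS _ _ (nbhs_filter (p, 0 : R)) _ _ _ N) => q qL j jq; split.
    apply: regular_eq (near_outside_to q.2 jq qL) _.
    by apply: regularX; exact: to_cod.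
  rewrite -(divergence_near_eq m (near_outside_to q.2 jq qL)).
  by apply: consX.2; exact: to_cod.
have N1 := near_chart ip (regular_smoothed (to_cod ip) (regularX (to_cod ip))).
have N2 := near_chart ip (divergence_smoothed (to_cod ip)).
apply: (@filterS _ _ (nbhs_filter (p, 0 : R)) _ _ _ (filterI N1 N2)).
move=> q [[iq /= Rq] [_ /= Dq]] j jq.
have Rj := regular_push iq jq Rq; split; first exact: Rj.
have E : tr j i (to (ch j) q.1) = to (ch i) q.1 by exact: transition_to.
have dRi c : differentiable (fun x => local_field (smoothed_field q.2) i x 0 c)
    (tr j i (to (ch j) q.1)).
  by rewrite E; exact: regular_differentiable Rq.
have dRj c := regular_differentiable c Rj.
by have := divergence_push m (overlap_to jq iq) dRi dRj; rewrite E Dq.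
Qed.

Lemma smoothness_near p : smooth_point X p ->
  \forall q \near (p, 0 : R), smooth_point (smoothed_field q.2) q.1.
Proof.
move=> sp; have [pL|/in_support ip] := pselect ((~` support) p).
  have N1 : \forall q \near (p, 0 : R), (~` support) q.1.
    by apply: near_fst; apply: open_nbhs_nbhs.
  have N2 := near_fst (smooth_point_near sp).
  apply: (@filterS _ _ (nbhs_filter (p, 0 : R)) _ _ _ (filterI N1 N2)).
  move=> q [qL [j jq Rq]]; exists j => //.
  exact: regular_eq (near_outside_to q.2 jq qL) Rq.
have N := near_chart ip (regular_smoothed (to_cod ip) (smooth_point_chart sp ip)).
apply: (@filterS _ _ (nbhs_filter (p, 0 : R)) _ _ _ N) => q [iq Rq].
by exists i.
Qed.

Let close_at j (q : 'rV[R]_n * R) (d : R) :=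
  `|local_field X j q.1 - local_field (smoothed_field q.2) j q.1| < d /\
  `|'J (local_field X j) q.1 - 'J (local_field (smoothed_field q.2) j) q.1| < d.

Lemma closeness_near j (y : 'rV[R]_n) (d : R) : cod (ch j) y -> 0 < d ->
  \forall q \near (y, 0 : R), close_at j q d.
Proof.
move=> cy d0; have [yL|/in_support iy] := pselect ((~` support) (from (ch j) y)).
  have N1 : \forall q \near (y, 0 : R), (~` support) (from (ch j) q.1).
    have n0 : \forall z \near y, (~` support) (from (ch j) z).
      by apply: (near_from cy); apply: open_nbhs_nbhs.
    exact: (near_fst n0).
  have N2 : \forall q \near (y, 0 : R), cod (ch j) q.1.
    exact: (near_fst (near_of_open (@cod_open _ _ _ (ch j)) cy)).
  apply: (@filterS _ _ (nbhs_filter (y, 0 : R)) _ _ _ (filterI N1 N2)).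
  move=> q [qL cq]; have E := near_outside q.2 cq qL; split.
    by rewrite (nbhs_singleton E) subrr normr0.
  rewrite (near_eq_jacobian E) ?subrr ?normr0//.
    exact/regular_differentiable_rV/regularX.
  exact/regular_differentiable_rV/(regular_eq E)/regularX.
have oy : ov j i y by split.
have sE : tr j i y = to (ch i) (from (ch j) y) by [].
have [l1 l2 nd] := local_correction_small (to_cod iy).
pose u e (c : 'I_n) z := local_correction e z 0 c.
pose v e (b : 'I_n) z :=
  local_field (smoothed_field e) j z 0 b - local_field X j z 0 b.
have uv e : pushed i j (u e) (v e) by exact: add_field_pushed.
have [lv ldv] := push_limit uv oy nd l1 l2.
have d20 : 0 < d / 2 by rewrite divr_gt0.
have n1 : \forall q \near (y, 0 : R), forall b, `|v q.2 b q.1| < d / 2.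
  have H b : \forall q \near (y, 0 : R), `|v q.2 b q.1| < d / 2.
    by have /cvgr0Pnorm_lt/(_ _ d20) := lv b.
  exact: (filter_forall (nbhs_filter (y, 0 : R)) H).
have n2 : \forall q \near (y, 0 : R), forall b, forall c, `|pd c (v q.2 b) q.1| < d / 2.
  have H b c : \forall q \near (y, 0 : R), `|pd c (v q.2 b) q.1| < d / 2.
    by have /cvgr0Pnorm_lt/(_ _ d20) := ldv b c.
  have H' b := filter_forall (nbhs_filter (y, 0 : R)) (H b).
  exact: (filter_forall (nbhs_filter (y, 0 : R)) H').
have n3 : \forall q \near (y, 0 : R),
    regular predT [set 1%N] (local_field (smoothed_field q.2) j) q.1.
  have c1 : (fun q : 'rV[R]_n * R => q.1) @ (y, 0 : R) --> y by exact: cvg_fst.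
  have c2 : (fun q : 'rV[R]_n * R => q.2) @ (y, 0 : R) --> (0 : R) by exact: cvg_snd.
  have c3 : (fun q : 'rV[R]_n * R => from (ch j) q.1) @ (y, 0 : R) --> from (ch j) y.
    exact: (@cvg_comp _ _ _ (fun q : 'rV[R]_n * R => q.1) (from (ch j)) _ _ _ c1
      (from_continuous cy)).
  have c4 : (fun q : 'rV[R]_n * R => (from (ch j) q.1, q.2)) @ (y, 0 : R) -->
      (from (ch j) y, 0 : R) by exact: (cvg_pair c3 c2).
  have N1 : \forall q \near (y, 0 : R), forall l, dom (ch l) (from (ch j) q.1) ->
      regular predT [set 1%N] (local_field (smoothed_field q.2) l)
        (to (ch l) (from (ch j) q.1)) /\
      divergence m (smoothed_field q.2) l (to (ch l) (from (ch j) q.1)) = 0.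
    exact: (c4 _ (conservative_near (from (ch j) y))).
  have N2 : \forall q \near (y, 0 : R), cod (ch j) q.1.
    exact: (near_fst (near_of_open (@cod_open _ _ _ (ch j)) cy)).
  apply: (@filterS _ _ (nbhs_filter (y, 0 : R)) _ _ _ (filterI N1 N2)).
  move=> q [Hq cq]; have [] := Hq j (from_dom cq).
  by rewrite (fromK cq).
have n4 : \forall q \near (y, 0 : R), cod (ch j) q.1.
  exact: (near_fst (near_of_open (@cod_open _ _ _ (ch j)) cy)).
apply: (@filterS _ _ (nbhs_filter (y, 0 : R)) _ _ _
  (filterI (filterI n1 n2) (filterI n3 n4))) => q [[Vq DVq] [Rq cq]].
have d2d : d / 2 < d by rewrite ltr_pdivrMr// ltr_pMr// ltr1n.
split; apply: le_lt_trans d2d.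
  apply: norm_rV_le => [|b]; first exact: ltW.
  by rewrite mx_subE distrC; apply: ltW; exact: Vq.
have dX := regular_differentiable_rV (regularX cq).
have dXe := regular_differentiable_rV Rq.
apply: norm_mx_le => [|c b]; first exact: ltW.
rewrite mx_subE distrC; apply: le_trans (ltW (DVq b c)).
have dXb : derivable (fun z => local_field X j z 0 b) q.1 (basis_vec R c).
  exact/diff_derivable/differentiable_component.
have dXeb : derivable (fun z => local_field (smoothed_field q.2) j z 0 b) q.1
    (basis_vec R c).
  exact/diff_derivable/differentiable_component.
have [_ E] := derive_fB (derivableP dXeb) (derivableP dXb).
rewrite -[X in _ <= `|X|]/('D_(basis_vec R c) (fun z =>
  local_field (smoothed_field q.2) j z 0 b - local_field X j z 0 b) q.1) E.
rewrite le_eqVlt; apply/orP; left; apply/eqP; congr (`|_ - _|); exact: jacobianE.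
Qed.

End smoothing_step.

(** * From local to global *)

Section globalization.
Context {R : realType} {n : nat} {M : smooth_manifold R n}.
Variables (m : smooth_volume M) (G : C1_gauge M).
Hypothesis cM : compact [set: M].
Implicit Types (X : vector_field M) (C : set M) (x : 'rV[R]_n).

Lemma C1_close_refl X (d : R) : 0 < d -> C1_close G d X X.
Proof. by move=> d0 l x _ /=; rewrite !subrr !normr0. Qed.

Lemma C1_close_trans X X' X'' (d d' : R) : C1_close G d X X' ->
  C1_close G d' X' X'' -> C1_close G (d + d') X X''.
Proof.
move=> H H' l x lx; have [h1 h2] := H l x lx; have [h1' h2'] := H' l x lx.
split.
  rewrite -(subrKA (local_field X' (gauge_chart G l) x)).
  by apply: le_lt_trans (ler_normD _ _) _; exact: ltrD.
rewrite -(subrKA ('J (local_field X' (gauge_chart G l)) x)).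
by apply: le_lt_trans (ler_normD _ _) _; exact: ltrD.
Qed.

(** The form in which compactness is used: a property of pairs that holds near
    [(t, 0)] for every [t] in a compact set holds for all its points with one
    small parameter. *)
Lemma compact_near0 (T : topologicalType) (A : set T) (P : R -> T -> Prop) :
  compact A -> (forall t, A t -> \forall q \near (t, 0 : R), P q.2 q.1) ->
  \forall e \near (0 : R), forall t, A t -> P e t.
Proof.
move=> /compact_near_coveringP cA H.
exact: (cA _ (nbhs (0 : R)) P (nbhs_filter _) H).
Qed.

(** One small non-zero parameter serves the four properties of the smoothed
    field: it is conservative, close to [X] on the sets of the gauge, still
    smooth on [C], and it has gained the direction [a] near [x0]. *)
Lemma smooth_one_direction X i x0 (r : R) a C S (d : R) : 0 < r ->
  (forall x, `|x - x0| <= 2 * r -> cod (ch i) x) ->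
  conservative_C1 m X -> 0 < d -> compact C ->
  (forall p, C p -> smooth_point X p) ->
  (forall x, `|x - x0| <= r / 2 -> regular S setT (local_field X i) x) ->
  exists X', [/\ conservative_C1 m X', C1_close G d X X',
    forall p, C p -> smooth_point X' p &
    forall x, `|x - x0| <= r / 2 ->
      regular [predU1 a & S] setT (local_field X' i) x].
Proof.
move=> r0 x0r consX d0 cC CX SX.
have r20 : 0 < r / 2 by rewrite divr_gt0.
have r2r : r / 2 < r by rewrite ltr_pdivrMr// ltr_pMr// ltr1n.
pose Xe := smoothed_field m X i x0 r a.
have N1 : \forall e \near (0 : R), forall p, [set: M] p ->
    forall j, dom (ch j) p ->
    regular predT [set 1%N] (local_field (Xe e) j) (to (ch j) p) /\
    divergence m (Xe e) j (to (ch j) p) = 0.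
  apply: (@compact_near0 M setT (fun e p => forall j, dom (ch j) p ->
    regular predT [set 1%N] (local_field (Xe e) j) (to (ch j) p) /\
    divergence m (Xe e) j (to (ch j) p) = 0) cM) => p _.
  exact: conservative_near.
have N2 : \forall e \near (0 : R), forall l x, gauge_set G l x ->
    `|local_field X (gauge_chart G l) x - local_field (Xe e) (gauge_chart G l) x| < d /\
    `|'J (local_field X (gauge_chart G l)) x -
      'J (local_field (Xe e) (gauge_chart G l)) x| < d.
  have H l := @compact_near0 _ _ (fun e x =>
      `|local_field X (gauge_chart G l) x - local_field (Xe e) (gauge_chart G l) x| < d /\
      `|'J (local_field X (gauge_chart G l)) x -
        'J (local_field (Xe e) (gauge_chart G l)) x| < d)
    (@gauge_compact _ _ _ G l)
    (fun x lx => closeness_near a r0 x0r consX (@gauge_sub _ _ _ G l x lx) d0).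
  exact: (filter_forall (nbhs_filter (0 : R)) H).
have N3 := @compact_near0 _ _ (fun e p => smooth_point (Xe e) p) cC
  (fun p Cp => smoothness_near m a r0 x0r (CX p Cp)).
have xcod x : `|x - x0| <= r / 2 -> cod (ch i) x.
  by move=> xr; apply: x0r; lra.
have N4 : \forall e \near (0 : R), forall x, `|x - x0| <= r / 2 ->
    e != 0 -> regular [predU1 a & S] setT (local_field (Xe e) i) x.
  apply: (@compact_near0 _ _ (fun e x => e != 0 ->
    regular [predU1 a & S] setT (local_field (Xe e) i) x)
    (@compact_closed_ball _ _ x0 _ r20)) => x xr.
  exact: (regular_gain m a r0 (xcod x xr) (le_lt_trans xr r2r) (SX x xr)).
have N0 : \forall e \near (0 : R)^', e != 0.
  by apply/nbhs_dnbhs_neq.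
have [e [e0 [[H1 H2] [H3 H4]]]] := filter_ex (filterI N0 (nbhs_dnbhs
  (filterI (filterI N1 N2) (filterI N3 N4)))).
exists (Xe e); split.
- split=> [j|j x cx].
    apply: (@regular_Ck _ _ 1%N _ [set 1%N]) => //; first exact: cod_open.
    move=> x cx; have [] := H1 (from (ch j) x) I j (from_dom cx).
    by rewrite (fromK cx).
  by have [_] := H1 (from (ch j) x) I j (from_dom cx); rewrite (fromK cx).
- by move=> l x lx; exact: H2.
- exact: H3.
- by move=> x xr; exact: H4.
Qed.

(** Starting from mere continuity, every direction is gained in turn. The radius
    does not shrink: the gain holds on the same closed ball each time, because
    regularity in the directions already treated is preserved. *)
Lemma smooth_directions X i x0 (r : R) C (s : seq 'I_n) (d : R) : 0 < r ->
  (forall x, `|x - x0| <= 2 * r -> cod (ch i) x) ->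
  conservative_C1 m X -> 0 < d -> compact C ->
  (forall p, C p -> smooth_point X p) ->
  exists X', [/\ conservative_C1 m X', C1_close G d X X',
    forall p, C p -> smooth_point X' p &
    forall x, `|x - x0| <= r / 2 -> regular (mem s) setT (local_field X' i) x].
Proof.
move=> r0 x0r consX + cC CX; elim: s d => [|a s IH] d d0.
  (* With no direction at all, regularity of every order is continuity. *)
  exists X; split => //; first exact: C1_close_refl.
  move=> x xr; exists (cod (ch i)); split; first exact: cod_open.
    by apply: x0r; apply: le_trans xr _; lra.
  move=> k _ c; apply: (@Cp_subset _ _ pred0 _ _ (cod (ch i))) => //.
  apply: Cp_pred0 => z cz.
  have := Ck_Cp c (@cod_open _ _ _ (ch i)) (consX.1 i).
  by move=> /Cp_continuous/(_ cz).
have d20 : 0 < d / 2 by rewrite divr_gt0.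
have [X1 [cons1 close1 C1 S1]] := IH _ d20.
have [X2 [cons2 close2 C2 S2]] :=
  smooth_one_direction a r0 x0r cons1 d20 cC C1 S1.
exists X2; split => //; rewrite [d]splitr.
exact: C1_close_trans close2.
Qed.

(** The sets on which any conservative field can be made smooth by a small
    perturbation that preserves smoothness on a given compact set [C]; the latter
    is what allows two such sets to be treated one after the other. The compact
    set [K] is chosen before the field, to serve as a part of the next [C]. *)
Definition smoothable (A : set M) := exists2 K : set M, compact K /\ A `<=` K &
  forall X C (d : R), conservative_C1 m X -> 0 < d -> compact C ->
    (forall p, C p -> smooth_point X p) ->
    exists X', [/\ conservative_C1 m X', C1_close G d X X' &
      forall p, (C `|` K) p -> smooth_point X' p].

Lemma smoothable0 : smoothable set0.
Proof.
exists set0; first by split => //; exact: compact0.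
move=> X C d consX d0 cC CX; exists X; split => //; first exact: C1_close_refl.
by rewrite setU0.
Qed.

Lemma smoothable_sub A B : A `<=` B -> smoothable B -> smoothable A.
Proof. by move=> AB [K [cK BK] H]; exists K => //; split => // p /AB/BK. Qed.

Lemma smoothableU A B : smoothable A -> smoothable B -> smoothable (A `|` B).
Proof.
move=> [K [cK AK] HK] [L [cL BL] HL]; exists (K `|` L).
  by split; [exact: compactU|exact: setUSS].
move=> X C d consX d0 cC CX; have d20 : 0 < d / 2 by rewrite divr_gt0.
have [X1 [cons1 close1 C1]] := HK X C _ consX d20 cC CX.
have [X2 [cons2 close2 C2]] := HL X1 (C `|` K) _ cons1 d20 (compactU cC cK) C1.
exists X2; split => //; last by rewrite setUA.
by rewrite [d]splitr; exact: C1_close_trans close2.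
Qed.

Lemma smoothable_near (p : M) : exists2 A : set M, nbhs p A & smoothable A.
Proof.
have [i ip] := ch_cover p; set x0 := to (ch i) p.
have /nbhs_ballP[rho /= rho0 Hrho] : nbhs x0 (cod (ch i)).
  by apply: near_of_open; [exact: cod_open|exact: to_cod].
pose r := rho / 3; have r0 : 0 < r by rewrite divr_gt0.
have x0r x : `|x - x0| <= 2 * r -> cod (ch i) x.
  move=> xr; apply: Hrho; rewrite -ball_normE /= distrC.
  by apply: le_lt_trans xr _; rewrite /r; lra.
have r20 : 0 < r / 2 by rewrite divr_gt0.
pose D := [set x : 'rV[R]_n | `|x - x0| <= r / 2].
have Dcod : D `<=` cod (ch i).
  by move=> x Dx; apply: x0r; apply: le_trans Dx _; lra.
exists (dom (ch i) `&` (to (ch i) @^-1` D)).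
  apply: filterI; first by apply: open_nbhs_nbhs; split => //; exact: dom_open.
  apply: (to_continuous ip); apply/nbhs_ballP; exists (r / 2) => //= x.
  by rewrite -ball_normE /= distrC => /ltW.
exists (from (ch i) @` D).
  split; first by apply: compact_from_image => //; exact: compact_closed_ball.
  by move=> q [iq Dq]; exists (to (ch i) q) => //; rewrite toK.
move=> X C d consX d0 cC CX.
have [X' [cons' close' C' S']] :=
  smooth_directions (enum 'I_n) r0 x0r consX d0 cC CX.
exists X'; split => // q [/C' //|[x Dx <-]]; exists i; first exact/from_dom/Dcod.
rewrite fromK; last exact: Dcod.
by apply: regular_sub (S' x Dx) => // b _; rewrite mem_enum.
Qed.

(** The sets [A] with smoothable complement form a filter. If it were proper it
    would cluster at a point of the compact space [M], but that point has a
    smoothable neighbourhood. *)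
Lemma smoothableT : smoothable setT.
Proof.
apply: contrapT => nT.
pose F : set_system M := [set A | smoothable (~` A)].
have FF : ProperFilter F.
  split; first by rewrite /F /= setC0.
  split.
  - by rewrite /F /= setCT; exact: smoothable0.
  - by move=> A B FA FB; rewrite /F /= setCI; exact: smoothableU.
  - by move=> A B AB; apply: smoothable_sub; exact: subsetC.
have [p [_ pF]] := cM FF filterT.
have [A nA sA] := smoothable_near p.
have FA : F (~` A) by rewrite /F /= setCK.
by have [q [/=]] := pF _ _ FA nA.
Qed.

End globalization.

Theorem theorem3p1 (R : realType) (n : nat) (M : smooth_manifold R n)
    (m : smooth_volume M) (G : C1_gauge M) :
  compact [set: M] ->
  forall X, conservative_C1 m X ->
  forall e : R, 0 < e ->
  exists Z, conservative_Coo m Z /\ C1_close G e X Z.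
Proof.
move=> cM X consX e e0; have [K [_ KT] HK] := smoothableT m G cM.
have [Z [consZ closeZ smoothZ]] := HK X set0 e consX e0 compact0 (fun p => False_ind _).
exists Z; split => //; split; last exact: consZ.2.
move=> i k; apply: (@regular_Ck _ _ k _ setT) => //; first exact: cod_open.
move=> x cx; rewrite -(fromK cx); apply: smooth_point_chart; last exact: from_dom.
by apply: smoothZ; right; exact: KT.
Qed.
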